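(* Let $\mathfrak h$ be a $d$-dimensional abelian Lie algebra over $\mathbb C$ with a nondegenerate symmetric bilinear form, and let $\nu$ be an isometry of $\mathfrak h$ with $\nu^p=1$ ($p\ge1$) preserving a rational lattice in $\mathfrak h$. Let $\hat{\mathcal D}^+$ act on $S[\nu]$ by $L_n^{(r)}\mapsto L^{\nu;r}(n)$, $c\mapsto d$. Then $\mathcal U(\hat{\mathcal D}^+)\cdot1\subset S[\nu]$ is a quasi-finite highest weight $\hat{\mathcal D}^+$-module with generating highest weight vector $1$, whose generating function $\Delta(x)$ satisfies $$\Delta(x)=\frac12\frac{d}{dx}\sum_{k=0}^{p-1}\frac{(e^{\frac{kx}p}-1)\dim\mathfrak h_{(k)}}{1-e^x}.$$
   Context: $\mathbb N$ denotes the nonnegative integers. The algebra $\hat{\mathcal D}^+$. Let $D=t\frac{d}{dt}$ and let $\mathcal D$ be the Lie algebra of formal differential operators spanned by $t^nD^r$, $n\in\mathbb Z$, $r\in\mathbb N$, with bracket $[t^mf(D),t^ng(D)]=t^{m+n}(f(D+n)g(D)-g(D+m)f(D))$ for polynomials $f,g$. Let $\Psi$ be the 2-cocycle with $\Psi(t^mf(D),t^ng(D))=-\Psi(t^ng(D),t^mf(D))=\delta_{m+n,0}\sum_{i=1}^mf(-i)g(m-i)$ for $m>0$ (and $0$ for $m=n=0$). $\mathcal D^+$ is the Lie subalgebra of $\mathcal D$ generated (in fact spanned) by $L_n^{(r)}=(-1)^{r+1}D^r(t^nD)D^r$, $n\in\mathbb Z,r\in\mathbb N$. $\hat{\mathcal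 D}^+=\mathbb Cc\oplus\mathcal D^+$ is its central extension by the restricted cocycle $-\frac12\Psi$ ($c$ central). Highest weight modules. A highest weight $\hat{\mathcal D}^+$-module $W$ is one generated by a vector $w$ annihilated by all $L_n^{(r)}$ with $n>0$ and which is a simultaneous eigenvector for $c$ and the ''Cartan subalgebra'' elements $L_0^{(k)}$, $k\in\mathbb N$. It is quasi-finite if its homogeneous subspaces (for the grading in which $L_n^{(r)}$ has degree $n$) are finite-dimensional. Define the linear functional $\delta$ on the span of the $L_0^{(k)}$ by $L_0^{(k)}\cdot w=(-1)^k\delta(L_0^{(k)})w$ and the generating function $\Delta(x)=\sum_{k\ge0}\frac{\delta(L_0^{(k)})x^{2k}}{(2k)!}$. The space $S[\nu]$. Fix a primitive $p$-th root of unity $\omega_p$. For $r\in\mathbb Z$, $\mathfrak h_{(r)}=\{\alpha\in\mathfrak h:\nu\alpha=\omega_p^r\alpha\}$ and $\alpha_{(r)}$ is the projection of $\alpha$ on $\mathfrak h_{(r)}$. $\hat{\mathfrak h}[\nu]=\coprod_{n\in\frac1p\mathbb Z}\mathfrak h_{(pn)}\otimes t^n\oplus\mathbb CC$ with $C$ central and $[\alpha\otimes t^m,\beta\otimes t^n]=\langle\alpha,\beta\rangle m\,\delta_{m+n,0}C$ for $\alpha\in\mathfrak h_{(pm)}$, $\beta\in\mathfrak h_{(pn)}$. With $\hat{\mathfrak h}[\nu]^{\pm}=\coprod_{\pm n>0}\mathfrak h_{(pn)}\otimes t^n$, $S[\nu]=\mathcal U(\hat{\mathfrak h}[\nu])\otimes_{\mathcal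 U(\hat{\mathfrak h}[\nu]^+\oplus\mathfrak h_{(0)}\oplus\mathbb CC)}\mathbb C\simeq S(\hat{\mathfrak h}[\nu]^-)$, where $\hat{\mathfrak h}[\nu]^+\oplus\mathfrak h_{(0)}$ acts trivially on $\mathbb C$ and $C$ acts as $1$; $1\in S[\nu]$ is the canonical generator. For $\alpha\in\mathfrak h$, $n\in\frac1p\mathbb Z$, $\alpha^\nu(n)$ is the action of $\alpha_{(pn)}\otimes t^n$ on $S[\nu]$, and $\alpha^\nu\langle x\rangle=\sum_{n\in\frac1p\mathbb Z}\alpha^\nu(n)x^{-n}$. $\{\alpha_q\}_{q=1}^d$ is an orthonormal basis of $\mathfrak h$; the normal ordering ${:}\cdot{:}$ places $\alpha^\nu(n)$ with $n>0$ to the right. The existence of a $\nu$-stable rational lattice (a free abelian group spanning $\mathfrak h$ with rational-valued form) is a standing assumption. The operators. Put $$L^{\nu;y_1,y_2}\langle x\rangle=\frac12\sum_{q=1}^d{:}\alpha_q^\nu\langle e^{y_1}x\rangle\alpha_q^\nu\langle e^{y_2}x\rangle{:}-\frac12\frac{\partial}{\partial y_1}\Bigg(\sum_{k=0}^{p-1}\frac{(e^{\frac{k(-y_1+y_2)}p}-1)\dim\mathfrak h_{(k)}}{1-e^{-y_1+y_2}}\Bigg)=\sum_{n\in\mathbb Z,\,r_1,r_2\in\mathbb N}L^{\nu;r_1,r_2}(n)x^{-n}\frac{y_1^{r_1}y_2^{r_2}}{r_1!r_2!}$$ and $L^{\nu;r}(n)=L^{\nu;r,r}(n)$; these operators give a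 representation of $\hat{\mathcal D}^+$ on $S[\nu]$ via $L_n^{(r)}\mapsto L^{\nu;r}(n)$, $c\mapsto d$. *)

(* Defs.v *)
From HB Require Import structures.
From mathcomp Require Import all_boot all_order all_algebra.
From mathcomp Require Import generic_quotient ring_quotient.
From mathcomp Require Import boolp classical_sets functions cardinality fsbigop.
From mathcomp Require Import reals complex.
From mathcomp Require Import finmap monalg.

Set Implicit Arguments.
Unset Strict Implicit.
Unset Printing Implicit Defensive.

Import GRing.Theory Num.Theory.
Local Open Scope classical_set_scope.
Local Open Scope ring_scope.
Local Open Scope quotient_scope.

Section LinearAlgebra.
Variables (K : fieldType) (V : lmodType K).

Definition lspan (A : set V) : set V :=
  [set v | exists (n : nat) (a : 'I_n -> K) (b : 'I_n -> V),
     (forall i, A (b i)) /\ v = \sum_i a i *: b i].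

Definition is_subspace (W : set V) : Prop :=
  W 0 /\ forall (a : K) (u v : V), W u -> W v -> W (a *: u + v).

Definition finite_dim (W : set V) : Prop :=
  exists s : seq V, W = lspan [set` s].

Definition direct_sum_decomp (W : set V) (Wn : int -> set V) : Prop :=
  [/\ forall n, is_subspace (Wn n),
      forall n, Wn n `<=` W,
      W `<=` lspan (\bigcup_n Wn n) &
      forall (s : seq int) (v : int -> V), uniq s ->
        (forall n, Wn n (v n)) -> \sum_(n <- s) v n = 0 ->
        forall n, n \in s -> v n = 0].

End LinearAlgebra.

(* A formal power series in x is the sequence of its coefficients; one in y1, y2
   is the family F with F a b the coefficient of y1^a y2^b.  Sums of series are
   the pointwise sums of functions, but the pointwise product of functions is
   not the product of series. *)
Section PowerSeries.
Variable K : fieldType.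
Implicit Types f g : nat -> K.

Definition fps_const (a : K) : nat -> K := fun n => if n == 0%N then a else 0.

Definition fps_mul f g : nat -> K := fun n => \sum_(i < n.+1) f i * g (n - i)%N.

Definition fps_exp (a : K) : nat -> K := fun n => a ^+ n / n`!%:R.

Definition fps_deriv f : nat -> K := fun n => f n.+1 *+ n.+1.

(* K[[x]] is a domain, so the quotient, when it exists in K[[x]], is the only
   series q with q g = f (for g <> 0); see fps_divP. *)
Definition fps_div f g : nat -> K := xget 0 [set q | fps_mul q g = f].

(* The substitution x := - y1 + y2. *)
Definition fps_subst_diff f : nat -> nat -> K :=
  fun a b => f (a + b)%N * (-1) ^+ a *+ 'C(a + b, a).

Definition fps2_deriv1 (F : nat -> nat -> K) : nat -> nat -> K :=
  fun a b => F a.+1 b *+ a.+1.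

End PowerSeries.

Section PowerSeriesTheory.
Variable K : fieldType.

Fixpoint fps_quot_seq (f g : nat -> K) (n : nat) : seq K :=
  if n is m.+1 then
    let s := fps_quot_seq f g m in
    rcons s ((f m.+1 - \sum_(i < m) s`_i * g (m.+1 - i)%N) / g 1%N)
  else [::].

Lemma size_fps_quot_seq f g n : size (fps_quot_seq f g n) = n.
Proof. by elim: n => //= n IHn; rewrite size_rcons IHn. Qed.

Lemma nth_fps_quot_seq f g n i : (i < n)%N ->
  (fps_quot_seq f g n)`_i = (fps_quot_seq f g i.+1)`_i.
Proof.
elim: n => // n IHn; rewrite ltnS leq_eqVlt => /predU1P[->//|lt_in].
by rewrite -IHn //= nth_rcons size_fps_quot_seq lt_in.
Qed.

Lemma fps_divP (f g : nat -> K) : f 0%N = 0 -> g 0%N = 0 -> g 1%N != 0 ->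
  fps_mul (fps_div f g) g = f.
Proof.
move=> f0 g0 g1; rewrite /fps_div; case: xgetP => // /(_ (fun n =>
  (fps_quot_seq f g n.+1)`_n)) []; apply/funext => -[|n].
  by rewrite /fps_mul big_ord1 /= g0 mulr0 f0.
rewrite /fps_mul !big_ord_recr /= subnn g0 mulr0 addr0.
rewrite nth_rcons size_fps_quot_seq ltnn eqxx subSnn divfK //.
rewrite addrC; set S1 := \sum_(i < n) _; set S2 := \sum_(i < n) _.
suff -> : S2 = S1 by rewrite subrK.
apply: eq_bigr => i _; congr (_ * _); exact/esym/nth_fps_quot_seq.
Qed.

End PowerSeriesTheory.

Section Lie.
Variables (K : fieldType) (g : lmodType K) (br : g -> g -> g).

Definition lie_generated (A : set g) : set g :=
  [set x | forall H : set g, is_subspace H ->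
     (forall y z, H y -> H z -> H (br y z)) -> A `<=` H -> H x].

(* rho, restricted to the subalgebra H, is a representation of H on V *)
Definition lie_representation (H : set g) (V : lmodType K)
    (rho : g -> V -> V) : Prop :=
  [/\ forall x, H x -> forall (a : K) (u v : V),
        rho x (a *: u + v) = a *: rho x u + rho x v,
      forall x y, H x -> H y -> forall (a : K) (v : V),
        rho (a *: x + y) v = a *: rho x v + rho y v &
      forall x y, H x -> H y -> forall v : V,
        rho (br x y) v = rho x (rho y v) - rho y (rho x v)].

(* U(H) . w, the span of all x_1 (x_2 (... (x_n w))) with x_i in H *)
Definition env_orbit (H : set g) (V : lmodType K) (rho : g -> V -> V) (w : V) :
    set V :=
  lspan [set v | exists s : seq g, (forall x, x \in s -> H x) /\
                                   v = foldr rho w s].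

End Lie.

(* The induced module U(g) (x)_{U(b)} K_chi, where b is a subalgebra of g acting
   on K through chi : b -> K.  It is the quotient of the free associative
   algebra on the set g by
     - the two-sided ideal generated by the linear relations of g and by the
       x y - y x - [x, y], the quotient by which is U(g);
     - the left ideal generated by the x - chi(x), x in b. *)
Section InducedModule.
Variables (K : fieldType) (g : lmodType K) (br : g -> g -> g).
Variables (b : set g) (chi : g -> K).

Definition free_alg := {malg K[{fmonom g}]}.
HB.instance Definition _ := GRing.Lalgebra.on free_alg.

Lemma free_alg_scaleAr (a : K) (u v : free_alg) : a *: (u * v) = u * (a *: v).
Proof.
rewrite -!mul_malgC !mulrA; congr (_ * v); rewrite !malgM_def fgmulUg fgmulgU.
by apply: eq_bigr => k _; rewrite mulrC mul1m mulm1.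
Qed.

Definition letter (x : g) : free_alg := mkmalgU (fmu x) 1.

Definition env_relator : set free_alg :=
  [set r | (exists (a : K) (x y : g),
              r = letter (a *: x + y) - (a *: letter x + letter y)) \/
           (exists x y : g,
              r = letter x * letter y - letter y * letter x
                  - letter (br x y))].

Definition ind_relator : set free_alg :=
  [set r | (exists u v r0 : free_alg, env_relator r0 /\ r = u * r0 * v) \/
           (exists (u : free_alg) (x : g), b x /\
              r = u * (letter x - (chi x)%:A))].

Definition ind_ideal : {pred free_alg} :=
  fun u => `[< forall N : set free_alg,
                 is_subspace N -> ind_relator `<=` N -> N u >].

Fact ind_ideal_zmod_closed : zmod_closed ind_ideal.
Proof.
split=> [|u v /asboolP Nu /asboolP Nv]; apply/asboolP => N sN rN.
  by case: sN.
rewrite addrC -scaleN1r; case: (sN) => _; apply; first exact: Nv.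
exact: Nu.
Qed.
HB.instance Definition _ :=
  GRing.isZmodClosed.Build free_alg ind_ideal ind_ideal_zmod_closed.

Definition induced := Quotient.quot ind_ideal.
HB.instance Definition _ := GRing.Zmodule.on induced.

Definition ind_class (u : free_alg) : induced :=
  \pi_(Quotient.quot ind_ideal) u.
Definition ind_repr (s : induced) : free_alg :=
  repr (s : Quotient.quot ind_ideal).

Lemma ind_classP (u v : free_alg) :
  reflect (ind_class u = ind_class v) (u - v \in ind_ideal).
Proof. by rewrite Quotient.idealrBE; apply: eqP. Qed.

Lemma ind_reprK : cancel ind_repr ind_class.
Proof. exact: reprK. Qed.

Lemma ind_class_is_zmod_morphism : zmod_morphism ind_class.
Proof. exact: raddfB. Qed.
HB.instance Definition _ :=
  GRing.isZmodMorphism.Build free_alg induced ind_class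
    ind_class_is_zmod_morphism.

Lemma ind_idealZ (a : K) (u : free_alg) :
  u \in ind_ideal -> a *: u \in ind_ideal.
Proof.
move=> /asboolP Nu; apply/asboolP => N sN rN; rewrite -[_ *: _]addr0.
by case: (sN) => N0; apply => //; apply: Nu.
Qed.

Definition ind_scale (a : K) (s : induced) : induced :=
  ind_class (a *: ind_repr s).

Lemma ind_classZ (a : K) (u : free_alg) :
  ind_class (a *: u) = ind_scale a (ind_class u).
Proof.
apply/ind_classP; rewrite -scalerBr ind_idealZ //.
by apply/ind_classP; rewrite ind_reprK.
Qed.

Fact ind_scaleA a b' (s : induced) :
  ind_scale a (ind_scale b' s) = ind_scale (a * b') s.
Proof. by rewrite -[s]ind_reprK -!ind_classZ scalerA. Qed.

Fact ind_scale1 : left_id 1 ind_scale.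
Proof. by move=> s; rewrite -[s]ind_reprK -!ind_classZ scale1r. Qed.

Fact ind_scaleDr : right_distributive ind_scale +%R.
Proof.
move=> a s t; rewrite -[s]ind_reprK -[t]ind_reprK -raddfD -!ind_classZ.
by rewrite -raddfD -scalerDr.
Qed.

Fact ind_scaleDl (s : induced) : {morph ind_scale^~ s : a b' / a + b'}.
Proof.
by move=> a b'; rewrite -[s]ind_reprK -!ind_classZ -raddfD -scalerDl.
Qed.

HB.instance Definition _ := GRing.Zmodule_isLmodule.Build K induced
  ind_scaleA ind_scale1 ind_scaleDr ind_scaleDl.

Lemma ind_idealMl (w u : free_alg) : u \in ind_ideal -> w * u \in ind_ideal.
Proof.
move=> /asboolP Nu; apply/asboolP => N [N0 sN] rN.
apply: (Nu (fun v => N (w * v))); first split=> /=.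
- by rewrite mulr0.
- by move=> a u1 u2 N1 N2; rewrite mulrDr -free_alg_scaleAr; apply: sN.
move=> r [[u1 [v1 [r0 [Hr0 ->]]]]|[u1 [x [bx ->]]]]; apply: rN.
  by left; exists (w * u1), v1, r0; rewrite !mulrA.
by right; exists (w * u1), x; rewrite mulrA.
Qed.

Definition ind_act (x : g) (s : induced) : induced :=
  ind_class (letter x * ind_repr s).

Lemma ind_act_class (x : g) (u : free_alg) :
  ind_act x (ind_class u) = ind_class (letter x * u).
Proof.
apply/ind_classP; rewrite -mulrBr ind_idealMl //.
by apply/ind_classP; rewrite ind_reprK.
Qed.

Definition ind_one : induced := ind_class 1.

End InducedModule.

Section DifferentialOperators.
Variable K : fieldType.

(* sum_n t^n f_n(D) is the finitely supported family (f_n)_n *)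
Definition diffop := {malg {poly K}[int]}.
HB.instance Definition _ := GRing.Zmodule.on diffop.

Definition tD (n : int) (f : {poly K}) : diffop := mkmalgU n f.

Definition diffop_scale (a : K) (x : diffop) : diffop :=
  a%:P *: (x : {malg {poly K}[int]}).

Fact diffop_scaleA a b (x : diffop) :
  diffop_scale a (diffop_scale b x) = diffop_scale (a * b) x.
Proof. by rewrite /diffop_scale scalerA -polyCM. Qed.

Fact diffop_scale1 : left_id 1 diffop_scale.
Proof. by move=> x; rewrite /diffop_scale scale1r. Qed.

Fact diffop_scaleDr : right_distributive diffop_scale +%R.
Proof. by move=> a x y; rewrite /diffop_scale scalerDr. Qed.

Fact diffop_scaleDl (x : diffop) : {morph diffop_scale^~ x : a b / a + b}.
Proof. by move=> a b; rewrite /diffop_scale polyCD scalerDl. Qed.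

HB.instance Definition _ := GRing.Zmodule_isLmodule.Build K diffop
  diffop_scaleA diffop_scale1 diffop_scaleDr diffop_scaleDl.

(* composition: t^m f(D) t^n g(D) = t^(m+n) f(D+n) g(D) *)
Definition diffop_mul (x y : diffop) : diffop :=
  \sum_(m <- msupp x) \sum_(n <- msupp y)
     tD (m + n) ((mcoeff m x \Po ('X + n%:~R%:P)) * mcoeff n y).

Definition diffop_br (x y : diffop) : diffop :=
  diffop_mul x y - diffop_mul y x.

Definition cocycle_pos (m : nat) (f g : {poly K}) : K :=
  \sum_(1 <= i < m.+1) f.[- i%:R] * g.[(m - i)%:R].

Definition cocycle (x y : diffop) : K :=
  \sum_(m <- msupp x)
    match m with
    | Posz n => cocycle_pos n (mcoeff m x) (mcoeff (- m) y)
    | Negz n => - cocycle_pos n.+1 (mcoeff (- m) y) (mcoeff m x)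
    end.

Definition Lr (n : int) (r : nat) : diffop :=
  (-1) ^+ r.+1 *: diffop_mul (diffop_mul (tD 0 'X^r) (tD n 'X)) (tD 0 'X^r).

Definition Dplus : set diffop :=
  lie_generated diffop_br [set x | exists (n : int) (r : nat), x = Lr n r].

(* (z, x) stands for z c + x, in the central extension of the whole algebra of
   differential operators by - 1/2 Psi. *)
Definition dhat := (K^o * diffop)%type.
HB.instance Definition _ := GRing.Lmodule.on dhat.

Definition dhat_br (x y : dhat) : dhat :=
  (- (2%:R^-1 * cocycle x.2 y.2), diffop_br x.2 y.2).

Definition Dhat_plus : set dhat := [set x | Dplus x.2].

Definition chat : dhat := (1, 0).
Definition Lhat (n : int) (r : nat) : dhat := (0, Lr n r).

Section Modules.
Variables (V : lmodType K) (rho : dhat -> V -> V).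

Definition is_submodule (W : set V) : Prop :=
  is_subspace W /\ forall x v, Dhat_plus x -> W v -> W (rho x v).

Definition highest_weight_vector (w : V) : Prop :=
  [/\ w != 0,
      forall (n : int) (r : nat), 0 < n -> rho (Lhat n r) w = 0,
      exists a : K, rho chat w = a *: w &
      forall k : nat, exists a : K, rho (Lhat 0 k) w = a *: w].

Definition highest_weight_module (W : set V) (w : V) : Prop :=
  [/\ is_submodule W, highest_weight_vector w &
      W = env_orbit Dhat_plus rho w].

(* The homogeneous subspaces of the highest weight module W generated by w are
   those of its Z-grading for which w has degree 0, L_n^(r) has degree n and c
   has degree 0; such a grading is unique. *)
Definition module_grading (W : set V) (w : V) (Wn : int -> set V) : Prop :=
  [/\ direct_sum_decomp W Wn, Wn 0 w,
      forall (m n : int) (r : nat) (v : V),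
        Wn m v -> Wn (m + n) (rho (Lhat n r) v) &
      forall (m : int) (v : V), Wn m v -> Wn m (rho chat v)].

Definition quasi_finite (W : set V) (w : V) : Prop :=
  exists2 Wn : int -> set V,
    module_grading W w Wn & forall n, finite_dim (Wn n).

(* delta is only meaningful on the span of the L_0^(k). *)
Definition weight_functional (w : V) (delta : dhat -> K) : Prop :=
  (forall (a : K) (x y : dhat),
     lspan (range (Lhat 0)) x -> lspan (range (Lhat 0)) y ->
     delta (a *: x + y) = a * delta x + delta y) /\
  forall k : nat, rho (Lhat 0 k) w = ((-1) ^+ k * delta (Lhat 0 k)) *: w.

End Modules.

Definition generating_function (delta : dhat -> K) : nat -> K :=
  fun n => if odd n then 0 else delta (Lhat 0 n./2) / n`!%:R.

End DifferentialOperators.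

Section Lattice.
Variables (K : numFieldType) (h : vectType K) (form : {symmetric h}).

Definition rational_lattice (L : set h) : Prop :=
  (exists (n : nat) (b : 'I_n -> h),
     [/\ forall z : 'I_n -> int, \sum_i b i *~ z i = 0 -> forall i, z i = 0,
         L = [set v | exists z : 'I_n -> int, v = \sum_i b i *~ z i] &
         <<[seq b i | i : 'I_n]>>%VS = fullv]) /\
  forall x y, L x -> L y -> exists q : rat, form x y = ratr q.

End Lattice.

(* An index n in (1/p) Z is represented by the integer m = p n. *)
Section TwistedHeisenberg.
Variables (K : numFieldType) (h : vectType K) (form : {symmetric h}).
Variables (nu : 'End(h)) (p : nat) (omega : K).

Definition heig (r : int) : {vspace h} := passmx.leigenspace nu (omega ^ r).

(* alpha_(r): the projection along the sum of the other h_(k) *)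
Definition hproj (r : int) : 'End(h) :=
  daddv_pi (heig r)
    (\sum_(k < p | omega ^ (Posz k) != omega ^ r) heig k)%VS.

Lemma hproj_in r a : hproj r a \in heig r.
Proof. exact: memv_pi. Qed.

(* (x_m)_m, z stands for sum_m x_m (x) t^(m/p) + z C *)
Definition hhat_pred : {pred (int -> h) * K^o} :=
  fun x => `[< finite_set [set m | x.1 m != 0] /\
               forall m, x.1 m \in heig m >].

Fact hhat_submod_closed : submod_closed hhat_pred.
Proof.
split=> [|a x y /asboolP[xf xe] /asboolP[yf ye]]; apply/asboolP; split=> /=.
- suff -> : [set m : int | (0 : int -> h) m != 0] = set0 by exact: finite_set0.
  by apply/seteqP; split => m //=; rewrite eqxx.
- by move=> m; rewrite mem0v.
- apply: sub_finite_set (_ : finite_set ([set m | x.1 m != 0] `|`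
                                         [set m | y.1 m != 0])).
    move=> m /=; have [xm0|] := eqVneq (x.1 m) 0; last by left.
    by rewrite [X in X != 0](_ : _ = a *: x.1 m + y.1 m) // xm0 scaler0 add0r;
      right.
  by rewrite finite_setU.
- by move=> m; rewrite memvD ?memvZ.
Qed.
HB.instance Definition _ :=
  GRing.isSubmodClosed.Build K ((int -> h) * K^o)%type hhat_pred
    hhat_submod_closed.

Record hhat := Hhat { hval : (int -> h) * K^o; hvalP : hval \in hhat_pred }.
HB.instance Definition _ := [isSub for hval].
HB.instance Definition _ := [Choice of hhat by <:].
HB.instance Definition _ := [SubChoice_isSubLmodule of hhat by <:].

Fact heis_monom_subproof (m : int) (a : h) :
  ((fun k => if k == m then hproj m a else 0), 0 : K^o) \in hhat_pred.
Proof.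
apply/asboolP; split=> /= [|k].
  apply: sub_finite_set (finite_set1 m) => k /=.
  by have [//|_] := eqVneq k m; rewrite eqxx.
by have [->|_] := eqVneq k m; rewrite ?hproj_in ?mem0v.
Qed.

(* alpha^nu(m/p) is the action of this element. *)
Definition heis_monom (m : int) (a : h) : hhat := Hhat (heis_monom_subproof m a).

Fact heis_central_subproof (z : K) : ((0 : int -> h), z : K^o) \in hhat_pred.
Proof.
apply/asboolP; split=> /= [|k]; last by rewrite mem0v.
suff -> : [set m : int | (0 : int -> h) m != 0] = set0 by exact: finite_set0.
by apply/seteqP; split => m //=; rewrite eqxx.
Qed.

Definition heis_central (z : K) : hhat := Hhat (heis_central_subproof z).

Definition heis_br (x y : hhat) : hhat :=
  heis_central (\sum_(m \in [set: int])
    form ((hval x).1 m) ((hval y).1 (- m)) * (m%:~R / p%:R)).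

Definition heis_nonneg : set hhat :=
  [set x | forall m : int, m < 0 -> (hval x).1 m = 0].

(* C acts as 1, hhat^+ + h_(0) as 0 *)
Definition heis_vacuum (x : hhat) : K := (hval x).2.

Definition Snu := induced heis_br heis_nonneg heis_vacuum.
HB.instance Definition _ := GRing.Lmodule.on Snu.

Definition Snu_one : Snu := ind_one heis_br heis_nonneg heis_vacuum.

Definition alpha_op (a : h) (m : int) (v : Snu) : Snu :=
  ind_act (heis_monom m a) v.

(* :alpha^nu(m/p) beta^nu(n/p): *)
Definition normal_ord (a : h) (m : int) (b : h) (n : int) (v : Snu) : Snu :=
  if 0 < m then alpha_op b n (alpha_op a m v)
  else alpha_op a m (alpha_op b n v).

Definition dim_series : nat -> K :=
  \sum_(k < p)
    fps_div (fps_mul (fps_exp (k%:R / p%:R) - fps_const 1)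
                     (fps_const (\dim (heig k))%:R))
            (fps_const 1 - fps_exp 1).

Definition correction : nat -> nat -> K :=
  fun r1 r2 => - (2%:R^-1 * fps2_deriv1 (fps_subst_diff dim_series) r1 r2).

(* The coefficient of x^(-m/p) y^r in alpha^nu<e^y x> is the coefficient of y^r
   in e^(-(m/p) y) times alpha^nu(m/p). *)
Definition mode_coef (m : int) (r : nat) : K :=
  fps_exp (- (m%:~R / p%:R)) r.

(* L^(nu;r1,r2)(n), for an orthonormal basis e.  The sum over m has only
   finitely many nonzero terms on each vector v. *)
Definition Lnu2 (d : nat) (e : d.-tuple h) (r1 r2 : nat) (n : int) (v : Snu) :
    Snu :=
  (r1`! * r2`!)%:R *:
    (2%:R^-1 *: (\sum_(q < d) \sum_(m \in [set: int])
        (mode_coef m r1 * mode_coef (p%:Z * n - m) r2) *: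
        normal_ord (tnth e q) m (tnth e q) (p%:Z * n - m) v)
     + (if n == 0 then correction r1 r2 else 0) *: v).

Definition Lnu (d : nat) (e : d.-tuple h) (r : nat) (n : int) (v : Snu) : Snu :=
  Lnu2 e r r n v.

End TwistedHeisenberg.

(* Main.v *)
From HB Require Import structures.
Require Import Defs.
From mathcomp Require Import all_boot all_order all_algebra.
From mathcomp Require Import boolp classical_sets functions cardinality fsbigop.
From mathcomp Require Import reals complex.
From mathcomp Require Import finmap monalg.
From mathcomp Require Import ring zify.

Set Implicit Arguments.
Unset Strict Implicit.
Unset Printing Implicit Defensive.

(** The vacuum 1 spans the degree-0 part of the Fock space S[nu], which is graded
    by (1/p) N, and L^(nu;r)(n) lowers the degree by n.  Hence the operators with
    n > 0 kill 1, and those with n = 0 act on it by a scalar.  A normally ordered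
    product of total degree 0 annihilates the vacuum, so that scalar comes from
    the correction term alone (Lnu2_vac): L_0^(k) has eigenvalue
    (-1)^k / 2 times (2k+1)! times the coefficient of x^(2k+1) in the dimension
    series sum_k (e^(kx/p) - 1) dim h_(k) / (1 - e^x).  This gives the even
    coefficients of the generating function.

    The odd coefficients vanish by definition, so the derivative of the dimension
    series has to be even.  This holds because an isometry puts h_(k) and
    h_(p-k) in duality (dim_heig_sub), and because the quotient
    f_k(x) = (e^(kx/p) - 1) / (1 - e^x) satisfies f_k(-x) + f_(p-k)(x) = -1 for
    0 < k < p (dim_series_parity).

    Since S[nu] is a quotient of a free algebra by generators and relations, it
    has to be shown that 1 is not zero in it.  Wick's rule defines a linear
    functional on the free algebra, the vacuum expectation value, which kills
    all the relators and takes the value 1 at 1 (ind_one_neq0, Snu_one_neq0).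

    For quasi-finiteness, the component of degree n of the orbit of 1 consists
    of its vectors which have degree -n in S[nu] and on which L_0^(0), the
    opposite of the operator D, has the corresponding eigenvalue.  The relation
    [L_0^(0), L_n^(r)] = - n L_n^(r) makes these components a grading, with
    independence coming from the distinct eigenvalues, and they are
    finite-dimensional since the homogeneous parts of S[nu] are spanned by
    finitely many words in creation operators (env_orbit_quasi_finite). *)

Import Order.TTheory GRing.Theory Num.Theory.
Local Open Scope classical_set_scope.
Local Open Scope ring_scope.

(** * Formal power series and the dimension series *)

Section FpsRing.
Variable K : fieldType.
Implicit Types f g k : nat -> K.

(** The polynomial of the first n coefficients of f; products of series are
    computed on truncations. *)
Definition fps_trunc n f : {poly K} := \poly_(i < n) f i.

Lemma fps_mul_trunc N n f g : (n < N)%N ->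
  fps_mul f g n = (fps_trunc N f * fps_trunc N g)`_n.
Proof.
move=> nN; rewrite coefM; apply: eq_bigr => i _.
have iN : (i < N)%N by rewrite (leq_ltn_trans _ nN) // -ltnS.
by rewrite !coef_poly iN (leq_ltn_trans (leq_subr _ _) nN).
Qed.

Lemma fps_mulC f g : fps_mul f g = fps_mul g f.
Proof. by apply/funext => n; rewrite !(fps_mul_trunc _ _ (ltnSn n)) mulrC. Qed.

Lemma fps_mulA f g k : fps_mul f (fps_mul g k) = fps_mul (fps_mul f g) k.
Proof.
have coef_trunc_mul N n f1 f2 (q : {poly K}) : (n < N)%N ->
    (fps_trunc N (fps_mul f1 f2) * q)`_n
    = (fps_trunc N f1 * fps_trunc N f2 * q)`_n.
  move=> nN; rewrite !coefM; apply: eq_bigr => i _; congr (_ * _).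
  have iN : (i < N)%N by rewrite (leq_ltn_trans _ nN) // -ltnS.
  by rewrite coef_poly iN (fps_mul_trunc _ _ iN).
apply/funext => n; rewrite !(fps_mul_trunc _ _ (ltnSn n)).
by rewrite mulrC !coef_trunc_mul // mulrC mulrA.
Qed.

Lemma fps_mulDl f g k : fps_mul (f + g) k = fps_mul f k + fps_mul g k.
Proof.
apply/funext => n; rewrite /fps_mul -[RHS]big_split.
by apply: eq_bigr => i _; apply: mulrDl.
Qed.

Lemma fps_mulNl f k : fps_mul (- f) k = - fps_mul f k.
Proof.
apply/funext => n; rewrite /fps_mul -[RHS]sumrN.
by apply: eq_bigr => i _; apply: mulNr.
Qed.

Lemma fps_mulBl f g k : fps_mul (f - g) k = fps_mul f k - fps_mul g k.
Proof. by rewrite fps_mulDl fps_mulNl. Qed.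

Lemma fps_mul0l k : fps_mul 0 k = 0.
Proof. by apply/funext => n; apply: big1 => i _; rewrite mul0r. Qed.

Lemma fps_mul_suml (I : Type) (r : seq I) (P : pred I) (F : I -> nat -> K) k :
  fps_mul (\sum_(i <- r | P i) F i) k = \sum_(i <- r | P i) fps_mul (F i) k.
Proof.
pose m f := fps_mul f k; rewrite -[LHS]/(m _).
by rewrite (big_morph m (fun f g => fps_mulDl f g k) (fps_mul0l k)).
Qed.

Lemma fps_mul_constl (a : K) f n : fps_mul (fps_const a) f n = a * f n.
Proof.
rewrite /fps_mul big_ord_recl subn0 /= [X in _ + X]big1 ?addr0 // => i _.
by rewrite /fps_const /= mul0r.
Qed.

Lemma fps_const1_mul f : fps_mul (fps_const 1) f = f.
Proof. by apply/funext => n; rewrite fps_mul_constl mul1r. Qed.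

(** A series of order one is not a zero divisor. *)
Lemma fps_mul_eq0 f g : g 0%N = 0 -> g 1%N != 0 -> fps_mul f g = 0 -> f = 0.
Proof.
move=> g0 g1 fg0; apply/funext => n; elim/ltn_ind: n => n IHn.
have := congr1 (@^~ n.+1) fg0; rewrite /fps_mul !big_ord_recr /= subnn g0 mulr0.
rewrite addr0 subSn // subnn big1 => [|i _]; last by rewrite IHn ?mul0r.
by rewrite add0r => /eqP; rewrite mulf_eq0 (negPf g1) orbF => /eqP.
Qed.

(** The series f(-x). *)
Definition fps_neg f : nat -> K := fun n => (-1) ^+ n * f n.

Lemma fps_neg_mul f g : fps_neg (fps_mul f g) = fps_mul (fps_neg f) (fps_neg g).
Proof.
apply/funext => n; rewrite /fps_neg /fps_mul mulr_sumr; apply: eq_bigr => i _.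
by rewrite mulrACA -exprD subnKC // -ltnS.
Qed.

Lemma fps_neg_exp (a : K) : fps_neg (fps_exp a) = fps_exp (- a).
Proof. by apply/funext => n; rewrite /fps_neg /fps_exp mulrA -exprMn mulN1r. Qed.

Lemma fps_neg_const (a : K) : fps_neg (fps_const a) = fps_const a.
Proof.
apply/funext => n; rewrite /fps_neg /fps_const.
by case: eqP => [->|_]; rewrite ?mul1r ?mulr0.
Qed.

Lemma fps_negB f g : fps_neg (f - g) = fps_neg f - fps_neg g.
Proof. by apply/funext => n; rewrite /fps_neg -mulrBr. Qed.

Lemma fps_neg_sum (I : Type) (r : seq I) (P : pred I) (F : I -> nat -> K) :
  fps_neg (\sum_(i <- r | P i) F i) = \sum_(i <- r | P i) fps_neg (F i).
Proof.
rewrite (big_morph (@fps_neg) (id1 := 0) (op1 := +%R)) // => [f g|].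
  by apply/funext => n; apply: mulrDr.
by apply/funext => n; apply: mulr0.
Qed.

Lemma fps_exp0 : fps_exp (0 : K) = fps_const 1.
Proof.
by apply/funext => -[|n]; rewrite /fps_exp /fps_const ?expr0 ?divr1 // expr0n mul0r.
Qed.

End FpsRing.

Lemma fps_expD (K : numFieldType) (a b : K) :
  fps_mul (fps_exp a) (fps_exp b) = fps_exp (a + b).
Proof.
apply/funext => n; rewrite /fps_mul /fps_exp addrC exprDn mulr_suml.
apply: eq_bigr => i _; have le_in : (i <= n)%N by rewrite -ltnS.
have nz k : k`!%:R != 0 :> K by rewrite pnatr_eq0 -lt0n fact_gt0.
rewrite -(bin_fact le_in) -mulr_natl !natrM invfM invfM mulrA.
have bnz : 'C(n, i)%:R != 0 :> K by rewrite pnatr_eq0 -lt0n bin_gt0.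
by field; rewrite ?nz ?bnz.
Qed.

Section DimSeries.
Variables (K : numFieldType).

Lemma fps_den0 : (fps_const 1 - fps_exp 1 : nat -> K) 0%N = 0.
Proof.
by rewrite [LHS](_ : _ = fps_const (1 : K) 0 - fps_exp 1 0) // /fps_exp divr1 expr0 subrr.
Qed.

Lemma fps_den1 : (fps_const 1 - fps_exp 1 : nat -> K) 1%N != 0.
Proof.
rewrite (_ : (fps_const 1 - fps_exp 1 : nat -> K) 1%N = -1) ?oppr_eq0 ?oner_eq0 //.
by rewrite -[LHS]/(fps_const (1 : K) 1 - fps_exp 1 1) /fps_exp expr1n divr1 sub0r.
Qed.

Variables (h : vectType K) (nu : 'End(h)) (p : nat) (omega : K).
Hypothesis p_gt0 : (0 < p)%N.
Hypothesis dim_sym : forall k, (k <= p)%N ->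
  \dim (heig nu omega (p - k)%N) = \dim (heig nu omega k).

(** The reindexing k -> m + 1 - k behind the parity of the dimension series. *)
Lemma reflected_sum (m : nat) (dd u : nat -> K) :
    (forall k, (k <= m.+1)%N -> dd (m.+1 - k)%N = dd k) ->
  \sum_(k < m.+1) dd k * (u k - u 0%N)
  - \sum_(k < m.+1) dd k * (u (m.+1 - k)%N - u m.+1)
  = - \sum_(k < m) dd k.+1 * (u 0%N - u m.+1).
Proof.
move=> dd_sym; rewrite !big_ord_recl /= !subrr !mulr0 !add0r.
rewrite [X in _ - X](reindex_inj rev_ord_inj) -sumrB -sumrN.
apply: eq_bigr => i _; rewrite /bump /= !add1n.
have -> : (m.+1 - (m - i.+1).+1 = i.+1)%N by have := ltn_ord i; lia.
rewrite -(dd_sym i.+1) 1?ltnW ?ltnS //.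
have -> : (m.+1 - i.+1 = (m - i.+1).+1)%N by have := ltn_ord i; lia.
by ring.
Qed.

Let dimh k : nat -> K := fps_const (\dim (heig nu omega (k : nat)))%:R.

Lemma dim_series_mul_den :
  fps_mul (dim_series nu p omega) (fps_const 1 - fps_exp 1)
  = \sum_(k < p) fps_mul (fps_exp (k%:R / p%:R) - fps_const 1) (dimh k).
Proof.
rewrite /dim_series fps_mul_suml; apply: eq_bigr => k _; apply: fps_divP.
- rewrite /fps_mul big_ord1 /= -[X in X * _]/(fps_exp (k%:R / p%:R) 0 - fps_const 1 0).
  by rewrite /fps_exp divr1 expr0 subrr mul0r.
- exact: fps_den0.
exact: fps_den1.
Qed.

(** Up to its constant term, the dimension series is odd: with
    f_k(x) = (e^(kx/p) - 1) / (1 - e^x), one has f_k(-x) = - f_(p-k)(x) - 1 for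
    0 < k < p, and f_0 = 0. *)
Lemma dim_series_parity n : odd n = false -> (0 < n)%N ->
  dim_series nu p omega n = 0.
Proof.
move=> n_even n_gt0; set Q := dim_series nu p omega.
pose den : nat -> K := fps_const 1 - fps_exp 1.
pose c : K := - \sum_(k < p.-1) (\dim (heig nu omega k.+1))%:R.
suff /(congr1 (@^~ n)) : Q + fps_neg Q - fps_const c = 0.
  rewrite -[LHS]/(Q n + fps_neg Q n - fps_const c n).
  rewrite /fps_neg /fps_const gtn_eqF // subr0 -signr_odd n_even mul1r -mulr2n.
  by move=> /eqP; rewrite mulrn_eq0 => /eqP.
apply: (fps_mul_eq0 fps_den0 fps_den1); rewrite fps_mulBl fps_mulDl.
have -> : fps_mul (fps_neg Q) den
    = - \sum_(k < p) fps_mul (fps_exp ((p - k)%N%:R / p%:R) - fps_exp 1) (dimh k).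
  (* 1 - e^x = - (1 - e^(-x)) e^x *)
  have -> : den = - fps_mul (fps_neg den) (fps_exp 1).
    rewrite fps_negB fps_neg_const fps_neg_exp fps_mulBl fps_const1_mul fps_expD.
    by rewrite addNr fps_exp0 opprB.
  rewrite fps_mulC fps_mulNl fps_mulC fps_mulA -fps_neg_mul dim_series_mul_den.
  rewrite fps_neg_sum fps_mul_suml; congr (- _); apply: eq_bigr => k _.
  rewrite fps_neg_mul fps_neg_const -fps_mulA [fps_mul (dimh k) _]fps_mulC fps_mulA.
  congr (fps_mul _ _); rewrite fps_negB fps_neg_const fps_neg_exp fps_mulBl.
  rewrite fps_const1_mul fps_expD natrB ?(ltnW (ltn_ord k)) // mulrBl divff.
    by rewrite [- _ + 1]addrC.
  by rewrite pnatr_eq0 -lt0n.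
rewrite dim_series_mul_den; apply/funext => j.
have mul_dimhE (f : nat -> K) k :
    fps_mul f (dimh k) j = (\dim (heig nu omega k))%:R * f j.
  by rewrite fps_mulC fps_mul_constl.
rewrite -[LHS]/((\sum_(k < p) fps_mul _ _) j
  - (\sum_(k < p) fps_mul _ _) j - fps_mul _ _ j).
rewrite !fct_sumE fps_mul_constl /c.
under eq_bigr do rewrite mul_dimhE.
under [X in _ - X - _]eq_bigr do rewrite mul_dimhE.
pose u k : K := fps_exp (k%:R / p%:R) j.
have u0 : fps_const 1 j = u 0%N by rewrite -fps_exp0 /u mul0r.
have up : fps_exp 1 j = u p by rewrite /u divff // pnatr_eq0 -lt0n.
have := @reflected_sum p.-1 (fun k => (\dim (heig nu omega k))%:R) u.
rewrite prednK // => /(_ (fun k kp => congr1 _ (dim_sym kp))).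
rewrite -u0 -up => H; apply/eqP; rewrite subr_eq0; apply/eqP.
by rewrite -[X in _ = _ * X]/(fps_const 1 j - fps_exp 1 j) mulNr mulr_suml.
Qed.

End DimSeries.

(** * Duality of eigenspaces *)

Section EigenspaceDuality.
Variables (K : numFieldType) (h : vectType K) (form : {symmetric h}).
Variables (nu : 'End(h)) (p : nat) (omega : K).
Hypotheses (p_gt0 : (0 < p)%N) (nondeg : nondegenerate form).
Hypothesis (nu_iso : isometry form form nu).
Hypothesis (nu_order : forall a : h, iter p nu a = a).
Hypothesis (omega_order : omega ^+ p = 1).

Lemma heigP (r : int) (x : h) :
  reflect (nu x = omega ^ r *: x) (x \in heig nu omega r).
Proof.
rewrite /heig /passmx.leigenspace memv_ker add_lfunE opp_lfunE scale_lfunE id_lfunE.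
by rewrite subr_eq0; apply: eqP.
Qed.

Lemma form_eq0 (x : h) : (forall y, form x y = 0) -> x = 0.
Proof.
move=> x0; apply/eqP; rewrite -memv0 -(eqP nondeg); apply/mem_orthovP => v _.
exact: x0.
Qed.

Let omega_unit : omega \is a GRing.unit.
Proof.
rewrite unitfE; apply: contra_eq_neq omega_order => ->.
by rewrite expr0n gtn_eqF // eq_sym oner_eq0.
Qed.

(** An isometry pairs its eigenspaces for inverse eigenvalues nondegenerately. *)
Lemma heig_orthogonal_eq0 (r : int) (x : h) : x \in heig nu omega r ->
  (forall y, y \in heig nu omega (- r) -> form x y = 0) -> x = 0.
Proof.
move=> /heigP nux x0; apply: form_eq0 => y.
(* The average of the translates of y is a projection on the dual eigenspace. *)
pose av := \sum_(j < p) (omega ^ r) ^+ j *: iter j nu y.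
have w_p : (omega ^ r) ^+ p = 1.
  by rewrite -[LHS]/((omega ^ r) ^ (p : int)) exprzAC [omega ^ p]omega_order exp1rz.
have av_in : av \in heig nu omega (- r).
  apply/heigP; rewrite linear_sum scaler_sumr /av.
  case: p p_gt0 nu_order w_p => // m _ nu_m w_m.
  rewrite big_ord_recr [RHS]big_ord_recl /= addrC; congr (_ + _).
    rewrite linearZ /= -[nu (iter m nu y)]/(iter m.+1 nu y) nu_m scalerA.
    congr (_ *: _); rewrite mulr1 -[LHS]mul1r -(@divff _ (omega ^ r)).
      by rewrite mulrC mulrA [_ ^+ m * _]mulrC -exprS w_m mul1r invr_expz.
    by rewrite expfz_neq0 // -unitfE.
  apply: eq_bigr => i _; rewrite linearZ /= /bump add1n scalerA; congr (_ *: _).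
  by rewrite exprS mulrA -expfzDr -?unitfE // addNr mul1r.
have form_iter j : (omega ^ r) ^+ j * form x (iter j nu y) = form x y.
  elim: j => [|j <-]; first by rewrite mul1r.
  by rewrite -[form x (iter j nu y)]nu_iso nux linearZl_LR /= mulrA exprSr.
have := x0 _ av_in; rewrite linear_sum /=.
under eq_bigr do rewrite linearZ /= form_iter.
rewrite sumr_const card_ord => /eqP; rewrite mulrn_eq0 gtn_eqF //.
by move/eqP.
Qed.

Lemma dim_heig_opp_le (r : int) :
  (\dim (heig nu omega r) <= \dim (heig nu omega (- r)))%N.
Proof.
set b := vbasis (heig nu omega (- r)).
pose f x : 'rV[K]_(\dim (heig nu omega (- r))) := \row_j form x (tnth b j).
have f_lin : linear f.
  by move=> a x y; apply/rowP => j; rewrite !mxE linearPl.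
pose fL := GRing.isLinear.Build _ _ _ _ f f_lin.
pose F : {linear h -> 'rV[K]_(\dim (heig nu omega (- r)))} := HB.pack f fL.
rewrite -(limg_ker_dim (linfun F) (heig nu omega r)).
rewrite (_ : (_ :&: _)%VS = 0%VS) ?dimv0 ?add0n; last first.
  apply/eqP; rewrite -subv0; apply/subvP => x /memv_capP[xr].
  rewrite memv_ker lfunE /= => /eqP/rowP fx; rewrite memv0; apply/eqP.
  apply: (heig_orthogonal_eq0 xr) => y y_in.
  rewrite (coord_vbasis y_in) linear_sum big1 // => j _.
  by rewrite linearZ /= -tnth_nth; have := fx j; rewrite !mxE => ->; rewrite mulr0.
by rewrite (leq_trans (dimvS (subvf _))) // dimvf /dim /= mul1n.
Qed.

Lemma dim_heig_opp (r : int) : \dim (heig nu omega (- r)) = \dim (heig nu omega r).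
Proof.
apply/eqP; rewrite eqn_leq dim_heig_opp_le andbT.
by have := dim_heig_opp_le (- r); rewrite opprK.
Qed.

(** Since omega^p = 1, the eigenvalues omega^(p-k) and omega^(-k) agree. *)
Lemma dim_heig_sub (k : nat) : (k <= p)%N ->
  \dim (heig nu omega (p - k)%N) = \dim (heig nu omega k).
Proof.
move=> kp; rewrite -[RHS]dim_heig_opp; congr (\dim _).
rewrite /heig; congr passmx.leigenspace.
rewrite -subzn // expfzDr -?unitfE //.
by rewrite [omega ^ p]omega_order mul1r.
Qed.
End EigenspaceDuality.

(** * Linear spans and finite-dimensional subspaces *)

Section LinearSpans.
Variables (K : fieldType) (V : lmodType K).
Implicit Types A W : set V.

Lemma subspace_lspan A : is_subspace (lspan A).
Proof.
split; first by exists 0%N, (fun=> 0), (fun=> 0); split=> [[]|] //; rewrite big_ord0.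
move=> a _ _ [n [c [b [Ab ->]]]] [m [c' [b' [Ab' ->]]]].
exists (n + m)%N, (fun i : 'I_(n + m) =>
    match fintype.split i with inl j => a * c j | inr j => c' j end),
  (fun i : 'I_(n + m) => match fintype.split i with inl j => b j | inr j => b' j end).
split=> [i|]; first by case: (fintype.split i).
rewrite big_split_ord /= scaler_sumr; congr (_ + _); apply: eq_bigr => i _.
  by rewrite (unsplitK (inl i)) scalerA.
by rewrite (unsplitK (inr i)).
Qed.

Lemma lspan_incl A : A `<=` lspan A.
Proof.
move=> v Av; exists 1%N, (fun=> 1), (fun=> v); split=> //.
by rewrite big_ord1 scale1r.
Qed.

Section Subspace.
Variables (W : set V) (sW : is_subspace W).

Lemma subspace0 : W 0. Proof. by case: sW. Qed.

Lemma subspaceZ (a : K) v : W v -> W (a *: v).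
Proof. by case: sW => W0 Wl Wv; rewrite -[_ *: _]addr0; apply: Wl. Qed.

Lemma subspaceD u v : W u -> W v -> W (u + v).
Proof. by case: sW => _ Wl Wu Wv; rewrite -[u]scale1r; apply: Wl. Qed.

Lemma subspace_sum (I : Type) (r : seq I) (P : pred I) (F : I -> V) :
  (forall i, P i -> W (F i)) -> W (\sum_(i <- r | P i) F i).
Proof. by move=> WF; elim/big_ind: _ => //; [exact: subspace0|exact: subspaceD]. Qed.

Lemma subspace_fsum (I : choiceType) (D : set I) (F : I -> V) :
  (forall i, W (F i)) -> W (\sum_(i \in D) F i).
Proof. by move=> WF; apply: subspace_sum. Qed.

Lemma lspan_sub A : A `<=` W -> lspan A `<=` W.
Proof.
move=> AW _ [n [a [b [Ab ->]]]].
by apply: subspace_sum => i _; apply/subspaceZ/AW.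
Qed.

End Subspace.

Lemma lspanS A B : A `<=` B -> lspan A `<=` lspan B.
Proof.
move=> AB; apply: lspan_sub; first exact: subspace_lspan.
by move=> v /AB; apply: lspan_incl.
Qed.

(** A linear property of vectors holds on a span once it holds on generators. *)
Lemma lspan_ind A (P : V -> Prop) : P 0 ->
  (forall (a : K) u v, P u -> P v -> P (a *: u + v)) ->
  (forall v, A v -> P v) -> forall v, lspan A v -> P v.
Proof. by move=> P0 Pl; apply: lspan_sub. Qed.

Lemma lspan_cons (x : V) (s : seq V) v : lspan [set` x :: s] v ->
  exists a u, lspan [set` s] u /\ v = a *: x + u.
Proof.
apply: (@lspan_ind _ (fun v => exists a u, lspan [set` s] u /\ v = a *: x + u))
  => [|b _ _ [a1 [u1 [su1 ->]]] [a2 [u2 [su2 ->]]]|y].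
- by exists 0, 0; rewrite scale0r add0r; split=> //; apply: (subspace0 (subspace_lspan _)).
- exists (b * a1 + a2), (b *: u1 + u2); split.
    by case: (subspace_lspan [set` s]) => _; apply.
  by rewrite scalerDr scalerA scalerDl addrACA.
rewrite /= inE => /orP[/eqP ->|ys].
  by exists 1, 0; rewrite scale1r addr0; split=> //; apply: (subspace0 (subspace_lspan _)).
by exists 0, y; rewrite scale0r add0r; split=> //; apply: lspan_incl.
Qed.

Lemma subspaceI W1 W2 :
  is_subspace W1 -> is_subspace W2 -> is_subspace (W1 `&` W2).
Proof.
move=> [W10 W1l] [W20 W2l]; split=> // a u v [? ?] [? ?].
by split; [apply: W1l | apply: W2l].
Qed.

(** By induction on the spanning list. *)
Lemma finite_dim_sub (s : seq V) W :
  is_subspace W -> W `<=` lspan [set` s] -> finite_dim W.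
Proof.
elim: s W => [|x s IHs] W sW Ws.
  by exists [::]; apply/seteqP; split=> //; apply: (lspan_sub sW) => v.
have [s' Ws'] : finite_dim (W `&` lspan [set` s]).
  by apply: IHs => [|v []//]; apply: subspaceI => //; apply: subspace_lspan.
have [[w Ww ws]|Wsub] := pselect (exists2 w, W w & ~ lspan [set` s] w); last first.
  exists s'; rewrite -Ws'; apply/seteqP; split=> v; last by case.
  by move=> Wv; split=> //; apply: contrapT => nv; apply: Wsub; exists v.
have [a [u [su w_def]]] := lspan_cons (Ws _ Ww).
have a_neq0 : a != 0.
  by apply: contra_notN ws => /eqP a0; rewrite w_def a0 scale0r add0r.
exists (w :: s'); apply/seteqP; split=> v; last first.
  apply: (lspan_sub sW) => y; rewrite /= inE => /orP[/eqP->//|ys'].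
  by have /lspan_incl : [set` s'] y by []; rewrite -Ws' => -[].
move=> Wv; have [b [u' [su' v_def]]] := lspan_cons (Ws _ Wv).
have sp := subspace_lspan [set` w :: s'].
rewrite -[v](subrK ((b / a) *: w)); apply: subspaceD => //; last first.
  by apply: subspaceZ => //; apply: lspan_incl; rewrite /= mem_head.
have : (W `&` lspan [set` s]) (v - (b / a) *: w).
  split.
    rewrite addrC -scaleNr; case: sW => _; exact.
  rewrite v_def w_def scalerDr scalerA divfK // opprD addrACA subrr add0r.
  rewrite addrC -scaleNr.
  by case: (subspace_lspan [set` s]) => _; apply.
by rewrite Ws'; apply: lspanS => y; rewrite /= inE orbC => ->.
Qed.

(** Eigenvectors for distinct eigenvalues are linearly independent. *)
Lemma eigenvectors_free (I : eqType) (T : V -> V) (mu : I -> K) (s : seq I)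
    (v : I -> V) :
  (forall (a : K) x y, T (a *: x + y) = a *: T x + T y) -> injective mu ->
  (forall i, T (v i) = mu i *: v i) -> uniq s -> \sum_(i <- s) v i = 0 ->
  forall i, i \in s -> v i = 0.
Proof.
move=> Tl mu_inj; elim: s v => [//|j s IHs] v Tv /= /andP[js us] vs0.
have T0 : T 0 = 0 by have := Tl 1 0 0; rewrite !scale1r !addr0 => /eqP;
  rewrite -[X in X == _]addr0 (inj_eq (addrI _)) eq_sym => /eqP.
have Tsum (r : seq I) (w : I -> V) : T (\sum_(i <- r) w i) = \sum_(i <- r) T (w i).
  elim: r => [|k r IHr]; first by rewrite !big_nil.
  by rewrite !big_cons -[w k]scale1r Tl IHr !scale1r.
have TZ a x : T (a *: x) = a *: T x by rewrite -[a *: x]addr0 Tl T0 addr0.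
have vs i : i \in s -> v i = 0.
  move=> si; have /eqP : (mu i - mu j) *: v i = 0.
    apply: (IHs (fun k => (mu k - mu j) *: v k)) => // [k|].
      by rewrite TZ Tv !scalerA mulrC.
    have := congr1 T vs0; rewrite Tsum T0 => Tvs0.
    transitivity (\sum_(i0 <- j :: s) T (v i0) - mu j *: \sum_(i0 <- j :: s) v i0).
      rewrite !big_cons scalerDr opprD addrACA Tv subrr add0r scaler_sumr -sumrB.
      by apply: eq_bigr => k _; rewrite Tv scalerBl.
    by rewrite Tvs0 vs0 scaler0 subrr.
  rewrite scaler_eq0 subr_eq0 (inj_eq mu_inj) => /orP[/eqP ij|/eqP//].
  by rewrite -ij si in js.
move=> i; rewrite inE => /orP[/eqP->|/vs//]; move: vs0; rewrite big_cons.
by rewrite big_seq big1 ?addr0 // => k /vs.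
Qed.

End LinearSpans.

(** * The vacuum expectation value on words *)

Section WickFunctional.
Variables (K : fieldType) (T : Type) (chi : T -> K) (kappa : T -> T -> K).
Implicit Types (x y z : T) (u v w : seq T) (G : seq T -> K).

(** The sum, over all the letters y of w, of kappa x y times the value of G at
    w with this letter y removed. *)
Fixpoint contraction x w G : K :=
  if w is y :: w' then kappa x y * G w' + contraction x w' (fun u => G (y :: u))
  else 0.

Fixpoint wick_rec (n : nat) w : K :=
  match n, w with
  | n'.+1, x :: w' => chi x * wick_rec n' w' + contraction x w' (wick_rec n')
  | _, _ => 1
  end.

(** The vacuum expectation value of a word, computed by Wick's rule: the first
    letter x is either replaced with chi x, or contracted with a later one. *)
Definition wick w : K := wick_rec (size w) w.
Arguments wick : simpl never.

Lemma eq_contraction x w G G' :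
  (forall u, (size u).+1 = size w -> G u = G' u) ->
  contraction x w G = contraction x w G'.
Proof.
elim: w G G' => //= y w IHw G G' eqG; rewrite eqG //; congr (_ + _).
by apply: IHw => u su; apply: eqG; rewrite /= su.
Qed.

Lemma contraction_lin x w (a : K) G G' :
  contraction x w (fun u => a * G u + G' u)
  = a * contraction x w G + contraction x w G'.
Proof.
elim: w G G' => [|y w IHw] G G' /=; first by rewrite mulr0 addr0.
by rewrite IHw; ring.
Qed.

Lemma contractionZ x w (a : K) G :
  contraction x w (fun u => a * G u) = a * contraction x w G.
Proof. by elim: w G => [|y w IHw] G /=; rewrite ?mulr0 // IHw; ring. Qed.

Lemma contractionC x y w G :
  contraction x w (fun u => contraction y u G)
  = contraction y w (fun u => contraction x u G).
Proof.
elim: w G => //= z w IHw G; rewrite !contraction_lin IHw.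
by rewrite !addrA; congr (_ + _); ring.
Qed.

Lemma contraction_cat x u v G : contraction x (u ++ v) G
  = contraction x u (fun u' => G (u' ++ v))
    + contraction x v (fun v' => G (u ++ v')).
Proof. by elim: u G => [|y u IHu] G /=; rewrite ?add0r // IHu addrA. Qed.

Lemma wick_rec_enough n w : (size w <= n)%N -> wick_rec n w = wick w.
Proof.
rewrite /wick; elim/ltn_ind: n w => -[|n] IHn [|x w] //= sw.
rewrite (IHn n) // /wick; congr (_ + _); apply: eq_contraction => u su.
by rewrite !IHn //; lia.
Qed.

Lemma wick_cons x w : wick (x :: w) = chi x * wick w + contraction x w wick.
Proof.
rewrite /wick /=; congr (_ + _); apply: eq_contraction => u su.
by rewrite wick_rec_enough // -su.
Qed.

(** The relation x y - y x = kappa(x, y) - kappa(y, x) inside a word. *)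
Lemma wick_commutator u v x y :
  wick (u ++ x :: y :: v) - wick (u ++ y :: x :: v)
  = (kappa x y - kappa y x) * wick (u ++ v).
Proof.
elim: {u}_.+1 {-2}u (ltnSn (size u)) v => // n IHn [|z u] /= su v.
  rewrite !wick_cons /=.
  have contr_cons x' y' : contraction x' v (fun w => wick (y' :: w))
      = chi y' * contraction x' v wick
        + contraction x' v (fun w => contraction y' w wick).
    by rewrite -contraction_lin; apply: eq_contraction => w _; apply: wick_cons.
  by rewrite !contr_cons contractionC; ring.
rewrite !wick_cons !contraction_cat /= mulrDr.
have eq_u : contraction z u (fun u' => wick (u' ++ x :: y :: v))
    = contraction z u (fun u' =>
        (kappa x y - kappa y x) * wick (u' ++ v) + wick (u' ++ y :: x :: v)).
  apply: eq_contraction => u' su'; apply/eqP; rewrite -subr_eq; apply/eqP.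
  by apply: IHn; lia.
have eq_v : contraction z v (fun v' => wick (u ++ x :: y :: v'))
    = contraction z v (fun v' =>
        (kappa x y - kappa y x) * wick (u ++ v') + wick (u ++ y :: x :: v')).
  apply: eq_contraction => v' _; apply/eqP; rewrite -subr_eq; apply/eqP.
  exact: IHn.
have eq_w : wick (u ++ x :: y :: v)
    = (kappa x y - kappa y x) * wick (u ++ v) + wick (u ++ y :: x :: v).
  by apply/eqP; rewrite -subr_eq; apply/eqP/IHn.
rewrite eq_u eq_v eq_w !contraction_lin.
ring.
Qed.

(** A letter with zero contractions acts as the scalar chi z. *)
Lemma wick_central u v z : (forall x, kappa x z = 0) -> (forall x, kappa z x = 0) ->
  wick (u ++ z :: v) = chi z * wick (u ++ v).
Proof.
move=> oz zo; have contr0 w G : contraction z w G = 0.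
  by elim: w G => //= y w IHw G; rewrite zo mul0r add0r.
elim: {u}_.+1 {-2}u (ltnSn (size u)) v => // n IHn [|x u] /= su v.
  by rewrite wick_cons contr0 addr0.
rewrite !wick_cons !contraction_cat /= oz mul0r add0r IHn //.
rewrite (@eq_contraction _ _ _ (fun u' => chi z * wick (u' ++ v))); last first.
  by move=> u' su'; rewrite IHn //; lia.
rewrite [X in _ + (_ + X)](@eq_contraction _ _ _ (fun v' => chi z * wick (u ++ v'))).
  by rewrite !contractionZ; ring.
by move=> v' _; apply: IHn.
Qed.

Lemma wick_rcons u x : (forall y, kappa y x = 0) -> wick (rcons u x) = chi x * wick u.
Proof.
move=> ox; elim: {u}_.+1 {-2}u (ltnSn (size u)) => // n IHn [|z u] /= su.
  by rewrite wick_cons /= addr0.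
rewrite !wick_cons -cats1 contraction_cat /= ox mul0r !addr0 cats1 IHn //.
rewrite (@eq_contraction _ _ _ (fun u' => chi x * wick u')).
  by rewrite contractionZ; ring.
by move=> u' su'; rewrite cats1 IHn //; lia.
Qed.

End WickFunctional.

Section WickLinear.
Variables (K : fieldType) (g : lmodType K) (chi : g -> K) (kappa : g -> g -> K).
Hypothesis chi_lin : forall (a : K) x y, chi (a *: x + y) = a * chi x + chi y.
Hypothesis kappa_linl :
  forall (a : K) x y z, kappa (a *: x + y) z = a * kappa x z + kappa y z.
Hypothesis kappa_linr :
  forall (a : K) x y z, kappa z (a *: x + y) = a * kappa z x + kappa z y.

Lemma wick_linear u v (a : K) (x y : g) :
  wick chi kappa (u ++ (a *: x + y) :: v)
  = a * wick chi kappa (u ++ x :: v) + wick chi kappa (u ++ y :: v).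
Proof.
have contr_lin w G : contraction kappa (a *: x + y) w G
    = a * contraction kappa x w G + contraction kappa y w G.
  elim: w G => [|z w IHw] G /=; first by rewrite mulr0 addr0.
  by rewrite IHw kappa_linl; ring.
elim: {u}_.+1 {-2}u (ltnSn (size u)) v => // n IHn [|z u] /= su v.
  by rewrite !wick_cons contr_lin chi_lin; ring.
rewrite !wick_cons !contraction_cat /= kappa_linr IHn //.
rewrite (@eq_contraction _ _ _ _ _ _ (fun u' => a * wick chi kappa (u' ++ x :: v)
  + wick chi kappa (u' ++ y :: v))); last first.
  by move=> u' su'; apply: IHn; rewrite -ltnS (leq_ltn_trans _ su) // su' leqnSn.
rewrite [X in _ + (_ + (_ + X))](@eq_contraction _ _ _ _ _ _ (fun v' =>
    a * wick chi kappa (u ++ x :: v') + wick chi kappa (u ++ y :: v'))).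
  by rewrite !contraction_lin; ring.
by move=> v' _; apply: IHn.
Qed.

End WickLinear.

Lemma free_alg_ind (K : fieldType) (g : lmodType K) (P : free_alg g -> Prop) : P 0 ->
  (forall (a : K) (u v : free_alg g), P u -> P v -> P (a *: u + v)) ->
  (forall k : {fmonom g}, P (mkmalgU k 1)) -> forall u, P u.
Proof.
move=> P0 Pl Pk u; rewrite [u]monalgE.
elim: (msupp u : seq _) => [|k s IHs]; first by rewrite big_nil.
rewrite big_cons (_ : mkmalgU k _ = mcoeff k u *: mkmalgU k 1); first exact: Pl.
by apply/malgP => l; rewrite mcoeffZ !mcoeffU mulr_natr.
Qed.

Lemma free_alg_functional_eq0 (K : fieldType) (g : lmodType K) (F : free_alg g -> K) :
  (forall (a : K) (u v : free_alg g), F (a *: u + v) = a * F u + F v) ->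
  (forall k : {fmonom g}, F (mkmalgU k 1) = 0) -> forall u, F u = 0.
Proof.
move=> F_lin F_word; elim/(@free_alg_ind K g) => [|a u v Fu Fv|//].
  have := F_lin 1 0 0; rewrite scale1r addr0 mul1r => /eqP.
  by rewrite -[X in X == _]addr0 (inj_eq (addrI _)) eq_sym => /eqP.
by rewrite F_lin Fu Fv mulr0 addr0.
Qed.

(** The words form a basis of the free algebra. *)
Lemma free_alg_extend (K : fieldType) (g : lmodType K) (f : seq g -> K) :
  exists F : free_alg g -> K,
    (forall (a : K) (u v : free_alg g), F (a *: u + v) = a * F u + F v) /\
    forall k : {fmonom g}, F (mkmalgU k 1) = f k.
Proof.
exists (mmap idfun (fun k : {fmonom g} => f k)); split=> [a u v|k]; last first.
  by rewrite mmapU mul1r.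
rewrite mmapD; congr (_ + _); rewrite (mmapEw (msuppZ_le _ _)) mmapE big_distrr.
by apply: eq_bigr => k _; rewrite /= mcoeffZ mulrA.
Qed.

Section InducedNonzero.
Variables (K : fieldType) (g : lmodType K) (br : g -> g -> g).
Variables (b : set g) (chi : g -> K) (kappa : g -> g -> K).
Hypothesis chi_lin : forall (a : K) x y, chi (a *: x + y) = a * chi x + chi y.
Hypothesis kappa_linl :
  forall (a : K) x y z, kappa (a *: x + y) z = a * kappa x z + kappa y z.
Hypothesis kappa_linr :
  forall (a : K) x y z, kappa z (a *: x + y) = a * kappa z x + kappa z y.
Hypothesis kappa_b : forall x y, b x -> kappa y x = 0.
Hypothesis chi_br : forall x y, chi (br x y) = kappa x y - kappa y x.
Hypothesis kappa_brl : forall x y z, kappa (br x y) z = 0.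
Hypothesis kappa_brr : forall x y z, kappa z (br x y) = 0.

Let wordM (k l : {fmonom g}) :
  (mkmalgU k 1 : free_alg g) * mkmalgU l 1 = mkmalgU (mmul k l) 1.
Proof. by rewrite malgM_def fgmulUU mulr1. Qed.

Section Functional.
Variable F : free_alg g -> K.
Hypothesis F_lin : forall (a : K) (u v : free_alg g), F (a *: u + v) = a * F u + F v.
Hypothesis F_word : forall k : {fmonom g}, F (mkmalgU k 1) = wick chi kappa k.

Let F0 : F 0 = 0.
Proof.
have := F_lin 1 0 0; rewrite scale1r addr0 mul1r => /eqP.
by rewrite -[X in X == _]addr0 (inj_eq (addrI _)) eq_sym => /eqP.
Qed.

Let FB u v : F (u - v) = F u - F v.
Proof. by rewrite addrC -scaleN1r F_lin mulN1r addrC. Qed.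

Let FZ a u : F (a *: u) = a * F u.
Proof. by rewrite -[a *: u]addr0 F_lin F0 addr0. Qed.

Let F_ideal (r : free_alg g) :
  (forall k l : {fmonom g}, F (mkmalgU k 1 * r * mkmalgU l 1) = 0) ->
  forall u v, F (u * r * v) = 0.
Proof.
move=> r0 u v; move: u.
apply: (@free_alg_functional_eq0 _ _ (fun u => F (u * r * v))) => [a u1 u2|k].
  by rewrite !mulrDl -!scalerAl F_lin.
move: v; apply: (@free_alg_functional_eq0 _ _ (fun v => F (_ * r * v))) => // a v1 v2.
by rewrite mulrDr -free_alg_scaleAr F_lin.
Qed.

Let F_letter (k l : {fmonom g}) x :
  F (mkmalgU k 1 * letter x * mkmalgU l 1) = wick chi kappa (k ++ x :: l).
Proof. by rewrite /letter 2!wordM F_word !fmM fmU -catA. Qed.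

Let F_letter2 (k l : {fmonom g}) x y :
  F (mkmalgU k 1 * (letter x * letter y) * mkmalgU l 1)
  = wick chi kappa (k ++ x :: y :: l).
Proof. by rewrite /letter 3!wordM F_word !fmM !fmU -catA. Qed.

Let F_relator r : ind_relator br b chi r -> F r = 0.
Proof.
case=> [[u [v [r0 [r0P ->]]]]|[u [x [bx ->]]]].
  apply: F_ideal => k l; case: r0P => [[a [x [y ->]]]|[x [y ->]]].
    transitivity (wick chi kappa (k ++ (a *: x + y) :: l)
      - (a * wick chi kappa (k ++ x :: l) + wick chi kappa (k ++ y :: l))).
      rewrite mulrBr mulrDr mulrBl mulrDl -free_alg_scaleAr -scalerAl FB F_lin.
      by congr (_ - (_ * _ + _)); apply: F_letter.
    by rewrite wick_linear // subrr.
  transitivity (wick chi kappa (k ++ x :: y :: l) - wick chi kappa (k ++ y :: x :: l)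
    - wick chi kappa (k ++ br x y :: l)).
    rewrite !mulrBr !mulrBl !FB.
    congr (_ - _ - _); [exact: F_letter2 | exact: F_letter2 | exact: F_letter].
  by rewrite wick_commutator wick_central // chi_br subrr.
move: u.
apply: (@free_alg_functional_eq0 _ _ (fun u => F (u * _))) => [a u v|k].
  by rewrite mulrDl -scalerAl F_lin.
rewrite mulrBr -free_alg_scaleAr mulr1 FB FZ wordM !F_word fmM fmU cats1.
by rewrite wick_rcons ?subrr // => y; apply: kappa_b.
Qed.

Lemma ind_ideal_functional u : u \in ind_ideal br b chi -> F u = 0.
Proof.
move=> /asboolP /(_ [set u | F u = 0]) Fu; apply: Fu; last exact: F_relator.
by split=> [|a v w /= v0 w0]; [exact: F0 | rewrite F_lin v0 w0 mulr0 addr0].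
Qed.

End Functional.

(** Suppose that chi is linear and that a bilinear form kappa, zero on brackets,
    satisfies kappa(y, x) = 0 for x in b and
    chi [x, y] = kappa(x, y) - kappa(y, x).  Then the linear extension of wick
    to the free algebra vanishes on all relators and is 1 at 1. *)
Lemma ind_one_neq0 : ind_one br b chi != 0.
Proof.
have [F [F_lin F_word]] := free_alg_extend (wick chi kappa).
apply/negP => /eqP; rewrite -[RHS](raddf0 (ind_class br b chi)) => /ind_classP.
rewrite subr0 => /(ind_ideal_functional F_lin F_word).
rewrite (F_word mone : F 1 = _) fm1 => /eqP.
by rewrite /wick /= oner_eq0.
Qed.

End InducedNonzero.

(** * Induced modules and the twisted Heisenberg algebra *)

Section InducedAction.
Variables (K : fieldType) (g : lmodType K) (br : g -> g -> g).
Variables (b : set g) (chi : g -> K).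
Local Notation M := (induced br b chi).
Local Notation cls := (ind_class br b chi).

Lemma ind_class_lin (a : K) (u v : free_alg g) : cls (a *: u + v) = a *: cls u + cls v.
Proof.
by rewrite raddfD -[RHS]/(ind_scale a (cls u) + cls v) -ind_classZ.
Qed.

Lemma ind_class_relator (r : free_alg g) : ind_relator br b chi r -> cls r = 0.
Proof.
move=> rr; rewrite -(raddf0 cls); apply/ind_classP; rewrite subr0.
by apply/asboolP => N _; apply.
Qed.

Lemma ind_act_lin (x : g) (a : K) (s t : M) :
  ind_act x (a *: s + t) = a *: ind_act x s + ind_act x t.
Proof.
rewrite -[s]ind_reprK -[t]ind_reprK; move: (ind_repr s) (ind_repr t) => u v.
transitivity (cls (letter x * (a *: u + v))).
  by rewrite -ind_class_lin; apply: ind_act_class.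
rewrite mulrDr -free_alg_scaleAr ind_class_lin.
have := @ind_act_class K g br b chi x u; have := @ind_act_class K g br b chi x v.
by move: (ind_act x (cls u)) (ind_act x (cls v)) => s' t' -> ->.
Qed.

Lemma ind_act0 (x : g) : ind_act x (0 : M) = 0.
Proof.
have := ind_act_lin x 1 0 0; rewrite !scale1r addr0 => /eqP.
by rewrite -[X in X == _]addr0 (inj_eq (addrI _)) eq_sym => /eqP.
Qed.

Lemma ind_actZ (x : g) (a : K) (s : M) : ind_act x (a *: s) = a *: ind_act x s.
Proof. by rewrite -[a *: s]addr0 ind_act_lin ind_act0 addr0. Qed.

Lemma ind_act_linl (a : K) (x y : g) (s : M) :
  ind_act (a *: x + y) s = a *: ind_act x s + ind_act y s.
Proof.
rewrite -[s]ind_reprK !ind_act_class -ind_class_lin.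
apply/eqP; rewrite -subr_eq0 -raddfB; apply/eqP/ind_class_relator; left.
exists 1, (ind_repr s), (letter (a *: x + y) - (a *: letter x + letter y)).
split; first by left; exists a, x, y.
by rewrite mul1r mulrBl mulrDl scalerAl.
Qed.

Lemma ind_act0l (s : M) : ind_act 0 s = 0.
Proof.
have := ind_act_linl 1 0 0 s; rewrite !scale1r addr0 => /eqP.
by rewrite -[X in X == _]addr0 (inj_eq (addrI _)) eq_sym => /eqP.
Qed.

Lemma ind_act_comm (x y : g) (s : M) :
  ind_act x (ind_act y s) = ind_act y (ind_act x s) + ind_act (br x y) s.
Proof.
rewrite -[s]ind_reprK !ind_act_class; apply/eqP; rewrite addrC -subr_eq.
rewrite -subr_eq0 -!raddfB; apply/eqP/ind_class_relator; left.
exists 1, (ind_repr s), (letter x * letter y - letter y * letter x - letter (br x y)).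
split; first by right; exists x, y.
by rewrite mul1r !mulrBl !mulrA.
Qed.

Lemma ind_act_one (x : g) : b x ->
  ind_act x (ind_one br b chi) = chi x *: ind_one br b chi.
Proof.
move=> bx; rewrite ind_act_class -[_ *: _]ind_classZ.
apply/eqP; rewrite -subr_eq0 -raddfB; apply/eqP/ind_class_relator; right.
by exists 1, x; rewrite mulr1 mul1r.
Qed.

(** The induced module is spanned by the products of elements of the Lie
    algebra applied to its cyclic vector. *)
Lemma induced_ind (P : M -> Prop) : P 0 ->
  (forall (a : K) s t, P s -> P t -> P (a *: s + t)) -> P (ind_one br b chi) ->
  (forall x s, P s -> P (ind_act x s)) -> forall s, P s.
Proof.
move=> P0 Pl P1 Px s; rewrite -[s]ind_reprK.
elim/(@free_alg_ind K g): (ind_repr s) => [|a u v Pu Pv|k]; first by rewrite raddf0.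
  by rewrite ind_class_lin; apply: Pl.
rewrite -[k]fmK; elim: (k : seq g) => [|x w Pw]; first by rewrite -fmoneE.
have -> : mkmalgU (FMonom (x :: w)) 1 = letter x * (mkmalgU (FMonom w) 1 : free_alg g).
  rewrite /letter malgM_def fgmulUU mulr1; congr mkmalgU.
  by apply/eqP; rewrite fmP fmM fmU.
by rewrite -ind_act_class; apply: Px.
Qed.

End InducedAction.

Section HeisenbergFock.
Variables (K : numFieldType) (h : vectType K) (form : {symmetric h}).
Variables (nu : 'End(h)) (p : nat) (omega : K).
Local Notation hhat := (hhat nu omega).
Local Notation S := (Snu form nu p omega).
Local Notation vac := (Snu_one form nu p omega).
Implicit Types (x y : hhat) (m n : int).

Let comp x m : h := (hval x).1 m.

Let comp_lin (a : K) x y m : comp (a *: x + y) m = a *: comp x m + comp y m.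
Proof. by []. Qed.

Let comp_supp x : exists A : {fset int}, forall m, m \notin A -> comp x m = 0.
Proof.
have /asboolP [/finite_fsetP[A HA] _] := hvalP x; exists A => m mA.
apply/eqP; apply: contraNT mA => xm.
by have : [set` A] m by rewrite -HA.
Qed.

Let pairing x y m : K := form (comp x m) (comp y (- m)) * (m%:~R / p%:R).

Let pairing_neg x y m : pairing y x (- m) = - pairing x y m.
Proof.
rewrite /pairing opprK hermC expr0 mul1r /= rmorphN mulNr mulrN.
by [].
Qed.

(* The vacuum expectation value of x y, when x and y have no central part. *)
Let wick_pairing x y : K := \sum_(m \in [set: int]) if 0 < m then pairing x y m else 0.

Let wick_pairingE x y (A : {fset int}) :
  (forall m, m \notin A -> comp x m = 0) ->
  wick_pairing x y = \sum_(m <- A) if 0 < m then pairing x y m else 0.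
Proof.
move=> xA; apply: fsbigTE => m mA; case: ifP => // _.
by rewrite /pairing xA // linear0l mul0r.
Qed.

(** The Heisenberg bracket is the antisymmetrization of the pairing of the
    positive modes of x with the negative modes of y. *)
Lemma Snu_one_neq0 : vac != 0.
Proof.
apply: (@ind_one_neq0 _ _ _ _ _ wick_pairing).
- by [].
- move=> a x y z; have [A xA] := comp_supp x; have [B yB] := comp_supp y.
  have xAB m : m \notin (A `|` B)%fset -> comp x m = 0.
    by rewrite in_fsetU => /norP[/xA].
  have yAB m : m \notin (A `|` B)%fset -> comp y m = 0.
    by rewrite in_fsetU => /norP[_ /yB].
  have xyAB m : m \notin (A `|` B)%fset -> comp (a *: x + y) m = 0.
    by move=> mAB; rewrite comp_lin xAB // yAB // scaler0 addr0.
  rewrite (wick_pairingE _ xAB) (wick_pairingE _ yAB) (wick_pairingE _ xyAB).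
  rewrite mulr_sumr -big_split; apply: eq_bigr => m _ /=.
  case: ifP => _; last by rewrite mulr0 addr0.
  by rewrite /pairing comp_lin linearPl /=; ring.
- move=> a x y z; have [A zA] := comp_supp z.
  rewrite !(wick_pairingE _ zA) mulr_sumr -big_split; apply: eq_bigr => m _ /=.
  case: ifP => _; last by rewrite mulr0 addr0.
  by rewrite /pairing comp_lin linearPr /=; ring.
- move=> x y bx; apply: fsbig1 => m _; case: ifP => // m_gt0.
  by rewrite /pairing /comp bx ?oppr_lt0 // linear0r mul0r.
- move=> x y; have [A xA] := comp_supp x.
  have oppK : bijective (fun m : int => - m) by exists (fun m => - m) => m; rewrite opprK.
  rewrite (wick_pairingE _ xA) /wick_pairing (reindex_fsbigT _ _ oppK).
  rewrite (@fsbigTE _ _ _ _ A); last first.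
    move=> m mA; case: ifP => // _.
    by rewrite pairing_neg /pairing xA // linear0l mul0r oppr0.
  rewrite -sumrB /heis_vacuum /= (@fsbigTE _ _ _ _ A); last first.
    by move=> m mA; rewrite -/(comp _ _) xA // linear0l mul0r.
  apply: eq_bigr => m _; rewrite pairing_neg oppr_gt0.
  have [m0|m0|->] := ltrgt0P m; rewrite ?subr0 ?sub0r ?opprK //.
  by rewrite rmorph0 mul0r mulr0.
- move=> x y z; apply: fsbig1 => m _; case: ifP => // _.
  by rewrite /pairing /comp /= linear0l mul0r.
- move=> x y z; apply: fsbig1 => m _; case: ifP => // _.
  by rewrite /pairing /comp /= linear0r mul0r.
Qed.

End HeisenbergFock.

(** * The graded Fock space *)

Section TwistedModes.
Variables (K : numFieldType) (h : vectType K) (form : {symmetric h}).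
Variables (nu : 'End(h)) (p : nat) (omega : K).
Local Notation hhat := (hhat nu omega).
Local Notation S := (Snu form nu p omega).
Local Notation vac := (Snu_one form nu p omega).
Implicit Types (a b : h) (m n : int) (s t : S).

Lemma alpha_op_lin a m (c : K) s t :
  alpha_op a m (c *: s + t) = c *: alpha_op a m s + alpha_op a m t.
Proof. exact: ind_act_lin. Qed.

Lemma heis_monom_lin (c : K) a b m :
  heis_monom nu p omega m (c *: a + b)
  = c *: heis_monom nu p omega m a + heis_monom nu p omega m b.
Proof.
apply: val_inj; rewrite [RHS]surjective_pairing /=; congr (_, _); last first.
  by rewrite scaler0 addr0.
apply/funext => k; rewrite !fctE; case: eqP => _; first by rewrite linearP.
by rewrite scaler0 addr0.
Qed.

Lemma alpha_op_linl (c : K) a b m s :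
  alpha_op (c *: a + b) m s = c *: alpha_op a m s + alpha_op b m s.
Proof. by rewrite /alpha_op heis_monom_lin; apply: ind_act_linl. Qed.

(** The central element C acts as 1 on all of S[nu]. *)
Lemma heis_central_act (z : K) s :
  ind_act (heis_central nu omega z : hhat) s = z *: s :> S.
Proof.
have br0 (x : hhat) : heis_br form p (heis_central nu omega z) x = 0.
  rewrite /heis_br fsbig1 => [|m _]; last by rewrite /= linear0l mul0r.
  exact: val_inj.
elim/(@induced_ind _ _ (@heis_br _ _ form nu p omega)): s => [|c s t IHs IHt||x s IHs].
- by rewrite ind_act0 scaler0.
- by rewrite ind_act_lin IHs IHt scalerDr !scalerA mulrC.
- by apply: ind_act_one => m _.
rewrite ind_act_comm br0 ind_act0l addr0 -ind_actZ.
exact: (congr1 (ind_act x) IHs).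
Qed.

Lemma alpha_op_comm a b m n s : exists c : K, (m + n != 0 -> c = 0) /\
  alpha_op a m (alpha_op b n s) = alpha_op b n (alpha_op a m s) + c *: s.
Proof.
pose c := \sum_(k \in [set: int])
  form ((hval (heis_monom nu p omega m a)).1 k)
    ((hval (heis_monom nu p omega n b)).1 (- k)) * (k%:~R / p%:R).
exists c; split; last first.
  by rewrite /alpha_op ind_act_comm heis_central_act.
move=> mn; apply: fsbig1 => k _ /=; case: eqP => [->|_]; last by rewrite linear0l mul0r.
case: eqP => [nm|_]; last by rewrite linear0r mul0r.
by rewrite -nm subrr eqxx in mn.
Qed.

Lemma alpha_op_vac a m : 0 <= m -> alpha_op a m vac = 0.
Proof.
move=> m0; rewrite /alpha_op ind_act_one ?scale0r // => k k0 /=.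
by rewrite lt_eqF // (lt_le_trans k0).
Qed.

Lemma Lnu2_alpha (d : nat) (e : d.-tuple h) r1 r2 n s :
  Lnu2 e r1 r2 n s = (r1`! * r2`!)%:R *:
    (2%:R^-1 *: (\sum_(q < d) \sum_(m \in [set: int])
        (mode_coef K p m r1 * mode_coef K p (p%:Z * n - m) r2) *:
        if 0 < m then alpha_op (tnth e q) (p%:Z * n - m) (alpha_op (tnth e q) m s)
        else alpha_op (tnth e q) m (alpha_op (tnth e q) (p%:Z * n - m) s))
     + (if n == 0 then correction nu p omega r1 r2 else 0) *: s).
Proof. by []. Qed.

End TwistedModes.

(** In this section, the operators alpha(m/p) of a Heisenberg algebra act on V,
    and those with m >= 0 annihilate vac. *)
Section FockSpace.
Variables (K : numFieldType) (h : vectType K) (V : lmodType K) (vac : V).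
Variable alpha_op : h -> int -> V -> V.
Implicit Types (a b : h) (m n N : int) (s t : V).
Hypothesis alpha_op_lin : forall a m (c : K) s t,
  alpha_op a m (c *: s + t) = c *: alpha_op a m s + alpha_op a m t.
Hypothesis alpha_op_linl : forall (c : K) a b m s,
  alpha_op (c *: a + b) m s = c *: alpha_op a m s + alpha_op b m s.
Hypothesis alpha_op_comm : forall a b m n s, exists c : K, (m + n != 0 -> c = 0) /\
  alpha_op a m (alpha_op b n s) = alpha_op b n (alpha_op a m s) + c *: s.
Hypothesis alpha_op_vac : forall a m, 0 <= m -> alpha_op a m vac = 0.

Lemma linear_op0 (f : V -> V) :
  (forall (c : K) s t, f (c *: s + t) = c *: f s + f t) -> f 0 = 0.
Proof.
move=> f_lin; have := f_lin 1 0 0; rewrite !scale1r addr0 => /eqP.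
by rewrite -[X in X == _]addr0 (inj_eq (addrI _)) eq_sym => /eqP.
Qed.

(** The product of the creation operators alpha(-(j+1)/p), for (alpha, j) in w,
    applied to the vacuum. *)
Definition fock_word (w : seq (h * nat)) : V :=
  foldr (fun l s => alpha_op l.1 (Negz l.2) s) vac w.

(** The letter (alpha, j) stands for alpha(-(j+1)/p) and has degree j + 1. *)
Definition fock_degree (w : seq (h * nat)) : nat := \sum_(l <- w) l.2.+1.

(** The span of the words of degree N, where alpha(-m/p) has degree m. *)
Definition fock_space N : set V :=
  lspan [set s | exists2 w, s = fock_word w & fock_degree w = N :> int].

Lemma fock_space_sub N : is_subspace (fock_space N).
Proof. exact: subspace_lspan. Qed.

Lemma fock_space_vac : fock_space 0 vac.
Proof. by apply: lspan_incl; exists [::]; rewrite // /fock_degree big_nil. Qed.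

Lemma fock_space_neg N s : N < 0 -> fock_space N s -> s = 0.
Proof.
move=> N0; move: s; apply: (@lspan_ind _ _ _ (fun s => s = 0)) => // [c _ _ -> ->|_ [w -> wN]].
  by rewrite scaler0 addr0.
by rewrite -wN in N0.
Qed.

Lemma fock_space_map (f : V -> V) N N' :
  (forall (c : K) s t, f (c *: s + t) = c *: f s + f t) ->
  (forall w, fock_degree w = N :> int -> fock_space N' (f (fock_word w))) ->
  forall s, fock_space N s -> fock_space N' (f s).
Proof.
move=> f_lin f_word; have sub := fock_space_sub N'.
apply: (@lspan_ind _ _ _ (fun s => fock_space N' (f s))) => [|c s t Hs Ht|_ [w -> wN]].
- by rewrite linear_op0 //; apply: subspace0 sub.
- by rewrite f_lin; apply: (subspaceD sub) => //; apply: (subspaceZ sub).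
exact: f_word.
Qed.

Lemma fock_space_creation a (j : nat) N s :
  fock_space N s -> fock_space (N - Negz j) (alpha_op a (Negz j) s).
Proof.
apply: fock_space_map => [|w wN]; first exact: alpha_op_lin.
apply: lspan_incl; exists ((a, j) :: w) => //.
by rewrite /fock_degree big_cons -/(fock_degree w) PoszD wN NegzE opprK addrC.
Qed.

Lemma fock_space_alpha a m N s :
  fock_space N s -> fock_space (N - m) (alpha_op a m s).
Proof.
case: m => [m|j]; last exact: fock_space_creation.
apply: fock_space_map => [|w <-]; first exact: alpha_op_lin.
elim: w => [|[b j] w IHw] /=.
  by rewrite alpha_op_vac //; apply: subspace0 (fock_space_sub _).
have [c [c0 ->]] := alpha_op_comm a b m (Negz j) (fock_word w).
rewrite /fock_degree big_cons -/(fock_degree w) PoszD /=.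
apply: (subspaceD (fock_space_sub _)).
  have -> : j.+1%:Z + (fock_degree w)%:Z - m%:Z = (fock_degree w)%:Z - m%:Z - Negz j.
    by rewrite NegzE; lia.
  exact: fock_space_creation.
have [mj|/c0 ->] := eqVneq (m%:Z + Negz j) 0; last first.
  by rewrite scale0r; apply: subspace0 (fock_space_sub _).
apply: (subspaceZ (fock_space_sub _)); apply: lspan_incl; exists w => //.
by move: mj; rewrite NegzE; lia.
Qed.

(** The words with at most k letters alpha(-m/p), with alpha in a basis of h and
    0 < m <= B. *)
Fixpoint fock_generators (B k : nat) : seq V :=
  if k is k'.+1 then
    let G := fock_generators B k' in
    G ++ [seq alpha_op l.1 (Negz l.2) s
         | l <- [seq (a, j) | a <- vbasis {:h}, j <- iota 0 B], s <- G]
  else [:: vac].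

Lemma fock_word_generators B k w :
  (size w <= k)%N -> all (fun l => l.2 < B)%N w ->
  lspan [set` fock_generators B k] (fock_word w).
Proof.
elim: k w => [|k IHk] [|[a j] w] //= sw.
- by move=> _; apply: lspan_incl; rewrite /= mem_head.
- move=> _; apply: lspanS (IHk [::] _ _) => // s /=.
  by rewrite mem_cat => ->.
move=> /andP[jB wB]; have := IHk w sw wB.
have sub := subspace_lspan [set` fock_generators B k.+1].
apply: (@lspan_ind _ _ _ (fun s => lspan _ (alpha_op a (Negz j) s))) => [|c s t Hs Ht|s].
- by rewrite linear_op0 //; apply: subspace0 sub.
- by rewrite alpha_op_lin; apply: (subspaceD sub) => //; apply: (subspaceZ sub).
move=> Gs; rewrite (coord_vbasis (memvf a)).
have alpha_suml (I : Type) (r : seq I) (c : I -> K) (F : I -> h) :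
    alpha_op (\sum_(i <- r) c i *: F i) (Negz j) s
    = \sum_(i <- r) c i *: alpha_op (F i) (Negz j) s.
  elim: r => [|i r IHr]; last by rewrite !big_cons alpha_op_linl IHr.
  rewrite !big_nil; have := alpha_op_linl 1 0 0 (Negz j) s.
  rewrite !scale1r addr0 => /eqP.
  by rewrite -[X in X == _]addr0 (inj_eq (addrI _)) eq_sym => /eqP.
rewrite alpha_suml; apply: (subspace_sum sub) => i _; apply: (subspaceZ sub).
apply: lspan_incl; rewrite /= mem_cat; apply/orP; right.
apply/allpairsP; exists ((vbasis {:h})`_i, j, s); split=> //=.
apply/allpairsP; exists ((vbasis {:h})`_i, j); split=> //=.
  by rewrite mem_nth // size_tuple.
by rewrite mem_iota.
Qed.

(** A word of degree N has at most N letters, each of degree at most N. *)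
Lemma fock_space_generators N :
  fock_space N `<=` lspan [set` fock_generators `|N| `|N|].
Proof.
apply: lspan_sub; first exact: subspace_lspan.
move=> _ [w -> <-]; rewrite absz_nat; apply: fock_word_generators.
  by rewrite /fock_degree -sum1_size leq_sum.
apply/allP => l lw; rewrite /fock_degree (big_rem l) //=.
by rewrite leq_addr.
Qed.

Lemma fock_space_normal_ord a m b n N s : fock_space N s ->
  fock_space (N - (m + n)) (if 0 < m then alpha_op b n (alpha_op a m s)
                            else alpha_op a m (alpha_op b n s)).
Proof.
move=> Ns; case: ifP => _.
  by rewrite opprD addrA; do 2!apply: fock_space_alpha.
by rewrite [m + n]addrC opprD addrA; do 2!apply: fock_space_alpha.
Qed.

End FockSpace.

Section TwistedFock.
Variables (K : numFieldType) (h : vectType K) (form : {symmetric h}).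
Variables (nu : 'End(h)) (p : nat) (omega : K) (d : nat) (e : d.-tuple h).
Local Notation S := (Snu form nu p omega).
Local Notation vac := (Snu_one form nu p omega).
Implicit Types (m n N : int) (s t : S).

(** The homogeneous subspace of S[nu] of degree N, in units of 1/p. *)
Definition Snu_space N : set S :=
  fock_space vac (@alpha_op K h form nu p omega) N.

Lemma Snu_space_sub N : is_subspace (Snu_space N).
Proof. exact: fock_space_sub. Qed.

Lemma Snu_space_vac : Snu_space 0 vac.
Proof. exact: fock_space_vac. Qed.

Lemma Snu_space_neg N s : N < 0 -> Snu_space N s -> s = 0.
Proof. exact: fock_space_neg. Qed.

Lemma Snu_space_generators N : exists G : seq S, Snu_space N `<=` lspan [set` G].
Proof.
eexists; apply: fock_space_generators.
  exact: alpha_op_lin.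
exact: alpha_op_linl.
Qed.

(** L^(nu;r1,r2)(n) lowers the degree by n, that is by p n units. *)
Lemma Lnu2_space r1 r2 n N s :
  Snu_space N s -> Snu_space (N - p%:Z * n) (Lnu2 e r1 r2 n s).
Proof.
move=> Ns; have sub := Snu_space_sub (N - p%:Z * n).
rewrite Lnu2_alpha; apply: (subspaceZ sub); apply: (subspaceD sub).
  apply: (subspaceZ sub); apply: (subspace_sum sub) => q _.
  apply: (subspace_fsum sub) => m; apply: (subspaceZ sub).
  rewrite -[X in Snu_space (_ - X)](subrKC m).
  exact: (fock_space_normal_ord (@alpha_op_lin K h form nu p omega)
    (@alpha_op_comm K h form nu p omega) (@alpha_op_vac K h form nu p omega)).
case: eqP => [->|_]; last by rewrite scale0r; apply: subspace0 sub.
by rewrite mulr0 subr0; apply: subspaceZ Ns; apply: Snu_space_sub.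
Qed.

(** Each normally ordered product of total degree 0 annihilates the vacuum, so
    that only the correction term remains. *)
Lemma Lnu2_vac r1 r2 :
  Lnu2 e r1 r2 0 vac = ((r1`! * r2`!)%:R * correction nu p omega r1 r2) *: vac.
Proof.
rewrite Lnu2_alpha eqxx -scalerA; congr (_ *: _).
rewrite big1 => [|q _]; first by rewrite scaler0 add0r.
apply: fsbig1 => m _; rewrite mulr0 sub0r.
have alpha0 a n : alpha_op a n (0 : S) = 0 by exact: ind_act0.
case: ifP => [m0|/negbT]; last rewrite -leNgt => m0.
  by rewrite (alpha_op_vac _ _ _ _ _ (ltW m0)) alpha0 scaler0.
by rewrite alpha_op_vac ?oppr_ge0 // alpha0 scaler0.
Qed.

End TwistedFock.

(** * Brackets with L_0^(0) and graded orbits *)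

Section DiffopBrackets.
Variable K : fieldType.
Implicit Types (f g : {poly K}) (m n : int) (r : nat) (x y : diffop K).

Lemma tDZ (a : K) n f : a *: tD n f = tD n (a *: f) :> diffop K.
Proof. by apply/malgP => k; rewrite mcoeffZ !mcoeffU -mul_polyC mulrnAr. Qed.

Lemma tDB n f g : tD n f - tD n g = tD n (f - g) :> diffop K.
Proof. by apply/malgP => k; rewrite mcoeffB !mcoeffU mulrnBl. Qed.

Lemma diffop_mul_tD m n f g :
  diffop_mul (tD m f) (tD n g) = tD (m + n) ((f \Po ('X + n%:~R%:P)) * g).
Proof.
rewrite /diffop_mul !msuppU; have [->|f0] := eqVneq f 0.
  by rewrite big_seq_fset0 comp_poly0 mul0r /tD monalgU0.
have [->|g0] := eqVneq g 0.
  by rewrite big_seq_fset1 big_seq_fset0 mulr0 /tD monalgU0.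
by rewrite !big_seq_fset1 !mcoeffUU.
Qed.

Lemma Lr_tD n r : exists f, Lr K n r = tD n f.
Proof. by eexists; rewrite /Lr !diffop_mul_tD tDZ add0r addr0. Qed.

Lemma Lr0 r : Lr K 0 r = tD 0 ((-1) ^+ r.+1 *: 'X^(r.*2.+1)).
Proof.
rewrite /Lr !diffop_mul_tD tDZ !mulr0z polyC0 !addr0 !comp_polyXr; congr (tD _ (_ *: _)).
by rewrite -exprSr -exprD addSn addnn.
Qed.

(** The element L_0^(0) is - D, the opposite of the degree operator. *)
Lemma br_Lr0 n r : diffop_br (Lr K 0 0) (Lr K n r) = (- n%:~R) *: Lr K n r.
Proof.
have [f ->] := Lr_tD n r; rewrite Lr0 expr1 scaleN1r /diffop_br !diffop_mul_tD.
rewrite mulr0z polyC0 !addr0 add0r tDB tDZ comp_polyXr; congr tD.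
rewrite raddfN /= comp_polyX -mul_polyC polyCN; ring.
Qed.

Lemma cocycle_Lr0 y : cocycle (Lr K 0 0) y = 0.
Proof.
rewrite Lr0 /cocycle msuppU; case: ifP => _; first by rewrite big_seq_fset0.
by rewrite big_seq_fset1 /= /cocycle_pos big_geq.
Qed.

Lemma dhat_br_L00 n r :
  dhat_br (Lhat K 0 0) (Lhat K n r) = (- n%:~R) *: Lhat K n r + 0.
Proof.
rewrite addr0 /dhat_br /= br_Lr0 cocycle_Lr0 mulr0 oppr0.
by rewrite [RHS]surjective_pairing /= scaler0.
Qed.

Lemma Dplus_sub : is_subspace (@Dplus K).
Proof.
split=> [|a x y Dx Dy].
  by move=> H [].
move=> H sH brH LH; case: (sH) => _; apply.
  exact: (Dx H sH brH LH).
exact: (Dy H sH brH LH).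
Qed.

Lemma Dplus_br x y : Dplus x -> Dplus y -> Dplus (diffop_br x y).
Proof.
move=> Dx Dy H sH brH LH.
by apply: (brH); [exact: (Dx H sH brH LH) | exact: (Dy H sH brH LH)].
Qed.

Lemma Dplus_Lr n r : Dplus (Lr K n r).
Proof. by move=> H sH brH; apply; exists n, r. Qed.

(** The linear form with value u i at t^0 D^i, and 0 at c and at t^n D^i for
    n <> 0. *)
Definition cartan_form (u : nat -> K) (x : dhat K) : K :=
  \sum_(i < size (mcoeff (0 : int) x.2)) (mcoeff (0 : int) x.2)`_i * u i.

Lemma cartan_formE (u : nat -> K) (x : dhat K) N : (size (mcoeff (0 : int) x.2) <= N)%N ->
  cartan_form u x = \sum_(i < N) (mcoeff (0 : int) x.2)`_i * u i.
Proof.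
move=> sN; rewrite /cartan_form.
rewrite (big_ord_widen _ (fun i => (mcoeff (0 : int) x.2)`_i * u i) sN).
rewrite big_mkcond; apply: eq_bigr => i _; case: ltnP => // si.
by rewrite nth_default ?mul0r.
Qed.

Lemma cartan_form_lin u (a : K) (x y : dhat K) :
  cartan_form u (a *: x + y) = a * cartan_form u x + cartan_form u y.
Proof.
have coefE : mcoeff (0 : int) (a *: x + y).2
    = a *: mcoeff (0 : int) x.2 + mcoeff (0 : int) y.2.
  by rewrite -mul_polyC -[(_ + _).2]/(a *: x.2 + y.2) mcoeffD mcoeffZ.
pose N := maxn (size (mcoeff (0 : int) x.2)) (size (mcoeff (0 : int) y.2)).
rewrite (@cartan_formE u x N) ?leq_maxl // (@cartan_formE u y N) ?leq_maxr //.
rewrite (@cartan_formE u _ N); last first.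
  rewrite coefE (leq_trans (size_polyD _ _)) // geq_max leq_maxr andbT.
  by rewrite (leq_trans (size_scale_leq _ _)) // leq_maxl.
rewrite mulr_sumr -big_split; apply: eq_bigr => i _.
by rewrite coefE coefD coefZ /=; ring.
Qed.

Lemma cartan_form_Lhat u k :
  cartan_form u (Lhat K 0 k) = (-1) ^+ k.+1 * u k.*2.+1.
Proof.
rewrite (@cartan_formE _ _ k.*2.+2) /= Lr0 mcoeffUU; last first.
  by rewrite (leq_trans (size_scale_leq _ _)) // size_polyXn.
rewrite big_ord_recr /= coefZ coefXn eqxx mulr1 big1 ?add0r // => i _.
by rewrite coefZ coefXn ltn_eqF ?mulr0 ?mul0r.
Qed.

End DiffopBrackets.

(** In this section, the space V of a representation contains subspaces U n, each
    contained in the span of a finite list, such that L_n^(r) maps U m into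
    U (m + n); the vector w lies in U 0 and is an eigenvector of L_0^(0). *)
Section GradedOrbit.
Variables (K : numFieldType) (V : lmodType K) (rho : dhat K -> V -> V) (w : V).
Variables (U : int -> set V) (c lambda : K).
Implicit Types (m n : int) (r : nat) (x y : dhat K) (v : V).
Hypothesis rho_rep : lie_representation (@dhat_br K) (@Dhat_plus K) rho.
Hypothesis rho_chat : forall v, rho (chat K) v = c *: v.
Hypothesis w_weight : rho (Lhat K 0 0) w = lambda *: w.
Hypothesis U_sub : forall n, is_subspace (U n).
Hypothesis U_w : U 0 w.
Hypothesis U_Lhat : forall m n r v, U m v -> U (m + n) (rho (Lhat K n r) v).
Hypothesis U_gen : forall n, exists s : seq V, U n `<=` lspan [set` s].

Local Notation Dp := (@Dhat_plus K).
Local Notation W := (env_orbit (@Dhat_plus K) rho w).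

Let rho_lin x (a : K) u v :
  Dp x -> rho x (a *: u + v) = a *: rho x u + rho x v.
Proof. by case: rho_rep => rl _ _ Dx; apply: rl. Qed.

Let rho_linl x y (a : K) v :
  Dp x -> Dp y -> rho (a *: x + y) v = a *: rho x v + rho y v.
Proof. by case: rho_rep => _ rl _ Dx Dy; apply: rl. Qed.

Let rho_br x y v :
  Dp x -> Dp y -> rho (dhat_br x y) v = rho x (rho y v) - rho y (rho x v).
Proof. by case: rho_rep => _ _ rb Dx Dy; apply: rb. Qed.

Let rhoZ x (a : K) v : Dp x -> rho x (a *: v) = a *: rho x v.
Proof.
move=> Dx; rewrite -[a *: v]addr0 rho_lin //.
by rewrite (@linear_op0 _ _ (rho x)) ?addr0 // => *; apply: rho_lin.
Qed.

Let Dp_Lhat n r : Dp (Lhat K n r). Proof. exact: Dplus_Lr. Qed.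

Let Dp0 : Dp 0. Proof. by case: (Dplus_sub K). Qed.

Let Dp_inr (x : diffop K) : Dplus x -> Dp (0, x). Proof. by []. Qed.

Let rho0 v : rho 0 v = 0.
Proof.
have := rho_linl 1 v Dp0 Dp0; rewrite !scale1r addr0 => /eqP.
by rewrite -[X in X == _]addr0 (inj_eq (addrI _)) eq_sym => /eqP.
Qed.

Let rho_split (z : K) (x : diffop K) v :
  Dplus x -> rho (z, x) v = (z * c) *: v + rho (0, x) v.
Proof.
move=> Dx; have -> : ((z, x) : dhat K) = z *: chat K + (0, x).
  by rewrite [RHS]surjective_pairing /= scaler0 add0r addr0 [z *: _]mulr1.
by rewrite rho_linl ?rho_chat ?scalerA //; case: (Dplus_sub K).
Qed.

Let W_sub : is_subspace W. Proof. exact: subspace_lspan. Qed.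

Let W_w : W w. Proof. by apply: lspan_incl; exists [::]. Qed.

Let W_rho x v : Dp x -> W v -> W (rho x v).
Proof.
move=> Dx; move: v; apply: (@lspan_ind _ _ _ (fun v => W (rho x v))).
- by rewrite -(scale0r 0) rhoZ // scale0r; apply: subspace0 W_sub.
- move=> a u v Wu Wv; rewrite rho_lin //.
  by apply: (subspaceD W_sub) => //; apply: subspaceZ W_sub _ _ _.
move=> _ [s [Ds ->]]; apply: lspan_incl; exists (x :: s); split=> // y.
by rewrite inE => /orP[/eqP->|/Ds].
Qed.

Lemma env_orbit_submodule : is_submodule rho W.
Proof. by split=> // x v; apply: W_rho. Qed.

(** The component of degree n: the eigenspace of L_0^(0) in W for the
    eigenvalue lambda - n, intersected with U n. *)
Definition orbit_component n : set V :=
  W `&` (U n `&` [set v | rho (Lhat K 0 0) v = (lambda - n%:~R) *: v]).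

Local Notation Wn := orbit_component.

Let Wn_sub n : is_subspace (Wn n).
Proof.
apply: subspaceI => //; apply: subspaceI => //; split=> [|a u v /= Hu Hv].
  by rewrite /= -(scale0r 0) rhoZ // !scale0r scaler0.
by rewrite rho_lin // Hu Hv scalerDr !scalerA mulrC.
Qed.

Let Wn_w : Wn 0 w.
Proof. by split=> //; split=> //=; rewrite subr0. Qed.

Let Wn_Lhat m n r v : Wn m v -> Wn (m + n) (rho (Lhat K n r) v).
Proof.
move=> [Wv [Uv /= Ev]]; split; first exact: W_rho.
split; first exact: U_Lhat.
(* [L_0^(0), L_n^(r)] = - n L_n^(r) shifts the eigenvalue by - n. *)
have shift (X X1 X2 t u : V) (a b : K) : X1 = a *: u -> X2 = b *: u + t -> t = 0 ->
    X2 = X - X1 -> X = (a + b) *: u.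
  move=> -> -> -> /eqP; rewrite addr0 eq_sym subr_eq => /eqP ->.
  by rewrite scalerDl addrC.
rewrite /= (_ : lambda - _ = lambda - m%:~R - n%:~R); last first.
  by rewrite rmorphD opprD addrA.
apply: (shift _ _ _ _ _ _ _ _ _ (rho0 v) (rho_br v (Dp_Lhat 0 0) (Dp_Lhat n r))).
  exact: etrans (congr1 (rho (Lhat K n r)) Ev) (rhoZ _ _ (Dp_Lhat n r)).
exact: etrans (congr1 (rho^~ v) (dhat_br_L00 K n r)) (rho_linl _ _ (Dp_Lhat n r) Dp0).
Qed.

Let Wn_chat m v : Wn m v -> Wn m (rho (chat K) v).
Proof. by move=> Wv; rewrite rho_chat; apply: subspaceZ (Wn_sub m) _ _ _. Qed.

Let Y := lspan (\bigcup_n Wn n).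

Let Y_sub : is_subspace Y. Proof. exact: subspace_lspan. Qed.

(* The elements of D^+ which preserve the sum of the components form a Lie
   subalgebra, because c acts as a scalar, and it contains the generators. *)
Let Y_rho x v : Dp x -> Y v -> Y (rho x v).
Proof.
pose H : set (diffop K) := [set x | Dplus x /\ forall v, Y v -> Y (rho (0, x) v)].
suff HD (y : diffop K) : Dplus y -> H y.
  case: x => z x Dx Yv; rewrite rho_split //.
  have [_ Hx] := HD _ Dx.
  by apply: (subspaceD Y_sub); [apply: subspaceZ Y_sub _ _ _ | apply: Hx].
move=> Dy; apply: (Dy H).
- split=> [|a x1 x2 [D1 H1] [D2 H2]].
    split=> [|u Yu]; first by case: (Dplus_sub K).
    by rewrite -[(0, 0)]/(0 : dhat K) rho0; apply: subspace0 Y_sub.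
  split; first by case: (Dplus_sub K) => _; apply.
  move=> u Yu; have -> : ((0, a *: x1 + x2) : dhat K) = a *: (0, x1) + (0, x2).
    by rewrite [RHS]surjective_pairing /= scaler0 addr0.
  rewrite rho_linl //; apply: (subspaceD Y_sub); last exact: H2.
  by apply: (subspaceZ Y_sub); apply: H1.
- move=> x1 x2 [D1 H1] [D2 H2]; have D12 := Dplus_br D1 D2; split=> // u Yu.
  pose z : K := - (2%:R^-1 * cocycle x1 x2).
  have -> : rho (0, diffop_br x1 x2) u = rho (0, x1) (rho (0, x2) u)
      + (-1) *: rho (0, x2) (rho (0, x1) u) + (- (z * c)) *: u.
    rewrite scaleN1r -(rho_br u (Dp_inr D1) (Dp_inr D2)).
    rewrite -[dhat_br _ _]/((z, diffop_br x1 x2) : dhat K).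
    by rewrite (rho_split z u D12) scaleNr addrAC subrr add0r.
  apply: (subspaceD Y_sub); last exact: subspaceZ.
  apply: (subspaceD Y_sub); first by apply/H1/H2.
  by apply: (subspaceZ Y_sub); apply/H2/H1.
- move=> _ [n [r ->]]; split; first exact: Dplus_Lr.
  apply: (@lspan_ind _ _ _ (fun v => Y (rho (Lhat K n r) v))).
  + by rewrite -(scale0r 0) rhoZ // scale0r; apply: subspace0 Y_sub.
  + move=> a u1 u2 Y1 Y2; rewrite rho_lin //.
    by apply: (subspaceD Y_sub) => //; apply: subspaceZ Y_sub _ _ _.
  move=> u [m _ Wu]; apply: lspan_incl; exists (m + n) => //.
  exact: Wn_Lhat.
Qed.

(** The components are independent since they belong to distinct eigenvalues of
    L_0^(0), and finite-dimensional since Wn n is contained in U n. *)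
Lemma env_orbit_quasi_finite : quasi_finite rho W w.
Proof.
exists Wn => [|n]; last first.
  have [s Us] := U_gen n; apply: (@finite_dim_sub _ _ s) => // v [_ [Uv _]].
  exact: Us.
split=> //; split=> //; first by move=> n v [].
  apply: lspan_sub => // _ [s [Ds ->]]; elim: s Ds => [|x s IHs] Ds /=.
    by apply: lspan_incl; exists 0.
  apply: Y_rho; first by apply: Ds; rewrite mem_head.
  by apply: IHs => y ys; apply: Ds; rewrite inE ys orbT.
move=> s v us Wv vs0.
apply: (@eigenvectors_free _ _ _ (rho (Lhat K 0 0)) (fun n => lambda - n%:~R)) => //.
- by move=> a x y; apply: rho_lin.
- by move=> i j /addrI/oppr_inj/intr_inj.
by move=> n; case: (Wv n) => _ [].
Qed.

End GradedOrbit.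

(** * The highest weight module generated by the vacuum *)

Section TwistedHighestWeight.
Variables (K : numFieldType) (h : vectType K) (form : {symmetric h}).
Variables (nu : 'End(h)) (p : nat) (omega : K) (d : nat) (e : d.-tuple h).
Local Notation S := (Snu form nu p omega).
Local Notation vac := (Snu_one form nu p omega).
Variable rho : dhat K -> S -> S.
Hypothesis rho_rep : lie_representation (@dhat_br K) (@Dhat_plus K) rho.
Hypothesis rho_Lhat : forall (n : int) (r : nat) v, rho (Lhat K n r) v = Lnu e r n v.
Hypothesis rho_chat : forall v, rho (chat K) v = d%:R *: v.
Local Notation W := (env_orbit (@Dhat_plus K) rho vac).

(** The eigenvalue of (-1)^k L_0^(k) on the vacuum. *)
Definition vacuum_weight (k : nat) : K :=
  2%:R^-1 * dim_series nu p omega k.*2.+1 * (k.*2.+1)`!%:R.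

(** As k! k! C(2k+1, k+1) (k+1) = (2k+1)!. *)
Lemma correction_vacuum_weight k :
  (k`! * k`!)%:R * correction nu p omega k k = (-1) ^+ k * vacuum_weight k.
Proof.
rewrite /correction /fps2_deriv1 /fps_subst_diff /vacuum_weight.
have <- : ('C(k.+1 + k, k.+1) * (k.+1`! * k`!))%N = (k.*2.+1)`!.
  by rewrite -[in k`!](addKn k.+1 k) bin_fact ?leq_addr // addSn addnn.
rewrite addSn addnn factS exprS.
rewrite -[_ *+ 'C(_, _)]mulr_natr -[_ *+ k.+1]mulr_natr !natrM.
move: (dim_series _ _ _ _) ('C(_, _)%:R : K) (k`!%:R : K) (k.+1%:R : K) => x y z t.
by move: ((-1) ^+ k) => u; ring.
Qed.

Lemma rho_Lhat0_vac k : rho (Lhat K 0 k) vac = ((-1) ^+ k * vacuum_weight k) *: vac.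
Proof. by rewrite rho_Lhat /Lnu Lnu2_vac correction_vacuum_weight. Qed.

Lemma rho_Lhat_pos_vac (n : int) r : (0 < p)%N -> 0 < n -> rho (Lhat K n r) vac = 0.
Proof.
move=> p_gt0 n_gt0; rewrite rho_Lhat.
apply: (Snu_space_neg (N := 0 - p%:Z * n)).
  by rewrite sub0r oppr_lt0 mulr_gt0 // ltz_nat.
exact/Lnu2_space/Snu_space_vac.
Qed.

Lemma vacuum_highest_weight : (0 < p)%N -> highest_weight_module rho W vac.
Proof.
move=> p_gt0; split=> //; first exact: env_orbit_submodule rho_rep.
split; first exact: Snu_one_neq0.
- by move=> n r; apply: rho_Lhat_pos_vac.
- by exists d%:R.
by move=> k; exists ((-1) ^+ k * vacuum_weight k); apply: rho_Lhat0_vac.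
Qed.

Lemma vacuum_quasi_finite : quasi_finite rho W vac.
Proof.
pose U (n : int) : set S := Snu_space (- (p%:Z * n)).
have w0 := rho_Lhat0_vac 0.
apply: (@env_orbit_quasi_finite _ _ rho vac U d%:R _ rho_rep rho_chat w0)
  => [n||m n r v|n].
- exact: Snu_space_sub.
- by rewrite /U mulr0 oppr0; apply: Snu_space_vac.
- rewrite /U mulrDr opprD rho_Lhat; exact: Lnu2_space.
exact: Snu_space_generators.
Qed.

(** A functional exists because L_0^(k) is (-1)^(k+1) D^(2k+1), so that the
    L_0^(k) are linearly independent. *)
Lemma weight_functional_vac : exists delta, weight_functional rho vac delta.
Proof.
exists (cartan_form (fun i => (-1) ^+ (i./2).+1 * vacuum_weight i./2)).
split=> [a x y _ _|k]; first exact: cartan_form_lin.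
rewrite rho_Lhat0_vac cartan_form_Lhat /= uphalf_double.
by rewrite signrMK.
Qed.

Lemma weight_functional_Lhat0 delta k : weight_functional rho vac delta ->
  delta (Lhat K 0 k) = vacuum_weight k.
Proof.
move=> [_ /(_ k)]; rewrite rho_Lhat0_vac => /eqP; rewrite -subr_eq0 -scalerBl.
rewrite scaler_eq0 (negPf (Snu_one_neq0 _ _ _ _)) orbF -mulrBr mulf_eq0.
by rewrite signr_eq0 /= subr_eq0 => /eqP.
Qed.

(** The odd coefficients of the generating function are 0 by definition; those of
    the derivative vanish by parity of the dimension series. *)
Lemma generating_function_vac delta n :
  (forall k, (k <= p)%N ->
     \dim (heig nu omega (p - k)%N) = \dim (heig nu omega k)) ->
  (0 < p)%N -> weight_functional rho vac delta ->
  generating_function delta n = 2%:R^-1 * fps_deriv (dim_series nu p omega) n.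
Proof.
move=> dim_sym p_gt0 wd; rewrite /generating_function /fps_deriv.
case: ifP => [n_odd|/negbT n_even].
  by rewrite (@dim_series_parity _ _ _ _ _ p_gt0) ?mul0rn ?mulr0 //= n_odd.
rewrite (weight_functional_Lhat0 _ wd) /vacuum_weight.
have nE : n./2.*2 = n by rewrite -[RHS]odd_double_half (negPf n_even).
rewrite nE factS natrM -[_ *+ _]mulr_natr; field.
by rewrite pnatr_eq0 -lt0n fact_gt0.
Qed.

End TwistedHighestWeight.

Theorem corollary7p4 (R : realType) (d : nat) (h : vectType R[i])
    (form : {symmetric h}) (nu : 'End(h)) (p : nat) (omega : R[i])
    (L : set h) (e : d.-tuple h)
    (rho : dhat R[i] -> Snu form nu p omega -> Snu form nu p omega) :
  \dim {:h} = d ->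
  nondegenerate form ->
  isometry form form nu ->
  (0 < p)%N ->
  (forall a : h, iter p nu a = a) ->
  rational_lattice form L ->
  nu @` L = L ->
  p.-primitive_root omega ->
  basis_of {:h} e ->
  orthonormal form e ->
  lie_representation (@dhat_br R[i]) (@Dhat_plus R[i]) rho ->
  (forall (n : int) (r : nat) v, rho (Lhat R[i] n r) v = Lnu e r n v) ->
  (forall v, rho (chat R[i]) v = d%:R *: v) ->
  let one := Snu_one form nu p omega in
  let W := env_orbit (@Dhat_plus R[i]) rho one in
  [/\ highest_weight_module rho W one,
      quasi_finite rho W one,
      exists delta, weight_functional rho one delta &
      forall delta, weight_functional rho one delta ->
        forall n : nat,
          generating_function delta n
          = 2%:R^-1 * fps_deriv (dim_series nu p omega) n].
Proof.
move=> _ nondeg nu_iso p_gt0 nu_order _ _ omega_prim _ _ rho_rep rho_Lhat rho_chat.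
move=> one W; split.
- exact: vacuum_highest_weight rho_rep rho_Lhat rho_chat p_gt0.
- exact: vacuum_quasi_finite rho_rep rho_Lhat rho_chat.
- exact: weight_functional_vac rho_Lhat.
move=> delta wd n.
have dim_sym k (kp : (k <= p)%N) := dim_heig_sub p_gt0 nondeg nu_iso nu_order
  (prim_expr_order omega_prim) kp.
exact: (generating_function_vac rho_Lhat n dim_sym p_gt0 wd).
Qed.
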